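(* Let $(\mathcal{M}^{2n+1},\varphi,\zeta,\eta,g)$ be an almost co-Kähler manifold satisfying the $\eta$-Einstein condition $$\mathrm{Ric}=a_1g+b_1\,\eta\otimes\eta,\qquad b_1\neq0,$$ with constant coefficients $a_1,b_1$. If $\mathcal{M}^{2n+1}$ is an $(m,\rho)$-quasi-Einstein manifold and $m\neq1$, then $\mathcal{M}^{2n+1}$ is a $K$-almost co-Kähler manifold, provided $ma_1\neq(2n-1)b_1$.
   Context: Almost contact metric manifold: a smooth manifold $\mathcal{M}^{2n+1}$ with a $(1,1)$-tensor field $\varphi$, a vector field $\zeta$, a 1-form $\eta$ and a Riemannian metric $g$ such that $\varphi^2=-I+\eta\otimes\zeta$, $\eta(\zeta)=1$, and $g(\varphi E,\varphi F)=g(E,F)-\eta(E)\eta(F)$ for all vector fields $E,F$. Its fundamental 2-form is $\Phi(E,F)=g(E,\varphi F)$. It is almost co-Kähler if $d\eta=0$ and $d\Phi=0$, and an almost co-Kähler manifold is $K$-almost co-Kähler if $\zeta$ is a Killing vector field. The manifold (or its metric $g$) is $(m,\rho)$-quasi-Einstein if there exist a smooth function $\omega:\mathcal{M}\to\mathbb{R}$ and constants $m,\rho,\lambda_1$, with $\rho,\lambda_1\in\mathbb{R}$ and $0<m\le\infty$, such that $$\mathrm{Ric}+\mathrm{Hess}\,\omega-\tfrac1m\,d\omega\otimes d\omega=(\rho\tau+\lambda_1)g,$$ where $\mathrm{Ric}$ is the Ricci tensor and $\tau$ the scalar curvature of $g$ (for $m=\infty$ the term $\tfrac1m\,d\omega\otimes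 d\omega$ is absent; for instance, an $(\infty,0)$-quasi-Einstein soliton is a gradient Ricci soliton). *)

(* Defs.v *)
From HB Require Import structures.
From mathcomp Require Import all_boot all_order all_algebra.
From mathcomp Require Import all_classical all_reals all_analysis.

Set Implicit Arguments.
Unset Strict Implicit.
Unset Printing Implicit Defensive.

Import Order.TTheory GRing.Theory Num.Theory.
Import numFieldNormedType.Exports.

Local Open Scope classical_set_scope.
Local Open Scope ring_scope.

Section Calculus.
Variables (R : realType) (d : nat).
Implicit Types (f : 'rV[R]_d -> R) (V : set 'rV[R]_d).

Definition partial (k : 'I_d) f : 'rV[R]_d -> R :=
  fun x => 'D_(delta_mx 0 k) f x.

Definition partials (s : seq 'I_d) f : 'rV[R]_d -> R := foldr partial f s.

(* C^oo on V, meant for V open: all iterated partial derivatives exist and are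
   continuous at the points of V. The values of f outside V are irrelevant. *)
Definition smooth_on V f : Prop :=
  forall (s : seq 'I_d) (x : 'rV[R]_d), V x ->
    {for x, continuous (partials s f)} /\
    forall k : 'I_d, derivable (partials s f) x (delta_mx 0 k).

End Calculus.

(* Second countable Hausdorff space with a C^oo atlas. The chart of index i is
   the homeomorphism coord i from dom i onto the open set img i of R^d, with
   inverse param i; all maps are total, and are only meaningful on dom i,
   respectively img i. *)
Record smooth_manifold (R : realType) (d : nat) := SmoothManifold {
  carrier :> topologicalType;
  carrier_hausdorff : hausdorff_space carrier;
  carrier_second_countable : @second_countable carrier;
  chart_index : Type;
  dom : chart_index -> set carrier;
  coord : chart_index -> carrier -> 'rV[R]_d;
  param : chart_index -> 'rV[R]_d -> carrier;
  dom_open : forall i, open (dom i);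
  dom_cover : forall p : carrier, exists i, dom i p;
  coordK : forall i p, dom i p -> param i (coord i p) = p;
  img_open : forall i, open (coord i @` dom i);
  coord_continuous : forall i, {within dom i, continuous (coord i)};
  param_continuous : forall i,
    {within coord i @` dom i, continuous (param i)};
  transition_smooth : forall i j (l : 'I_d),
    smooth_on (coord i @` (dom i `&` dom j))
      (fun x => coord j (param i x) 0 l)
}.

Section Fields.
Variables (R : realType) (d : nat) (M : smooth_manifold R d).

Definition img (i : chart_index M) : set 'rV[R]_d := coord i @` dom i.

(* Jacobian at p of the change of coordinates from chart i to chart j.
   Tangent vectors are row vectors, so that tangent maps, and likewise the
   matrices of (1,1)-tensors, act on the right. *)
Definition transition_jac (i j : chart_index M) (p : M) : 'M[R]_d :=
  'J (coord j \o param i) (coord i p).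

Definition smooth_fun (w : M -> R) : Prop :=
  forall i, smooth_on (img i) (w \o param i).

(* A tensor field is given by its components in each chart, as functions of the
   coordinates, subject to the transformation law on overlaps. *)
Record vector_field := VectorField {
  vf_comp :> chart_index M -> 'rV[R]_d -> 'rV[R]_d;
  vf_smooth : forall i k, smooth_on (img i) (fun x => vf_comp i x 0 k);
  vf_law : forall i j p, dom i p -> dom j p ->
    vf_comp j (coord j p) = vf_comp i (coord i p) *m transition_jac i j p
}.

Record one_form := OneForm {
  of_comp :> chart_index M -> 'rV[R]_d -> 'rV[R]_d;
  of_smooth : forall i k, smooth_on (img i) (fun x => of_comp i x 0 k);
  of_law : forall i j p, dom i p -> dom j p ->
    of_comp i (coord i p) = of_comp j (coord j p) *m (transition_jac i j p)^T
}.

Record endo_field := EndoField {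
  ef_comp :> chart_index M -> 'rV[R]_d -> 'M[R]_d;
  ef_smooth : forall i k l, smooth_on (img i) (fun x => ef_comp i x k l);
  ef_law : forall i j p, dom i p -> dom j p ->
    ef_comp i (coord i p) *m transition_jac i j p =
    transition_jac i j p *m ef_comp j (coord j p)
}.

Definition pairing (e u : 'rV[R]_d) : R := (u *m e^T) 0 0.

Definition bilin (G : 'M[R]_d) (u v : 'rV[R]_d) : R := (u *m G *m v^T) 0 0.

Record riemannian_metric := RiemannianMetric {
  rm_comp :> chart_index M -> 'rV[R]_d -> 'M[R]_d;
  rm_smooth : forall i k l, smooth_on (img i) (fun x => rm_comp i x k l);
  rm_law : forall i j p, dom i p -> dom j p ->
    rm_comp i (coord i p) =
    transition_jac i j p *m rm_comp j (coord j p) *m (transition_jac i j p)^T;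
  rm_sym : forall i x, img i x ->
    forall u v, bilin (rm_comp i x) u v = bilin (rm_comp i x) v u;
  rm_pos : forall i x, img i x ->
    forall u, u != 0 -> 0 < bilin (rm_comp i x) u u
}.

End Fields.

(* In coordinates, for a metric with component matrix G, a 1-form e, a 2-form F,
   a vector field Z and a function f. *)
Section LocalFormulas.
Variables (R : realType) (d : nat).
Implicit Types (G F : 'rV[R]_d -> 'M[R]_d) (e Z : 'rV[R]_d -> 'rV[R]_d).
Implicit Types (f : 'rV[R]_d -> R) (x : 'rV[R]_d).

Definition d0 f x : 'rV[R]_d := \row_k partial k f x.

Definition d1 e x (k l : 'I_d) : R :=
  partial k (fun y => e y 0 l) x - partial l (fun y => e y 0 k) x.

Definition d2 F x (j k l : 'I_d) : R :=
  partial j (fun y => F y k l) x + partial k (fun y => F y l j) x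
  + partial l (fun y => F y j k) x.

Definition lie_metric Z G x : 'M[R]_d := \matrix_(k, l)
  (\sum_j (Z x 0 j * partial j (fun y => G y k l) x
           + G x j l * partial k (fun y => Z y 0 j) x
           + G x k j * partial l (fun y => Z y 0 j) x)).

(* Levi-Civita connection: nabla_(d_a) d_b = \sum_c christoffel G c a b x d_c *)
Definition christoffel G (c a b : 'I_d) x : R :=
  2^-1 * \sum_l invmx (G x) c l *
    (partial a (fun y => G y b l) x + partial b (fun y => G y a l) x
     - partial l (fun y => G y a b) x).

(* R(d_a, d_b) d_c = \sum_l riemann G a b c l x d_l, where
   R(X, Y) = [nabla_X, nabla_Y] - nabla_[X, Y] *)
Definition riemann G (a b c l : 'I_d) x : R :=
  partial a (christoffel G l b c) x - partial b (christoffel G l a c) x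
  + \sum_k (christoffel G l a k x * christoffel G k b c x
            - christoffel G l b k x * christoffel G k a c x).

(* Ric(Y, Z) = trace of X |-> R(X, Y) Z *)
Definition ricci G x : 'M[R]_d :=
  \matrix_(b, c) \sum_a riemann G a b c a x.

Definition scalar_curvature G x : R := \tr (invmx (G x) *m ricci G x).

Definition hessian G f x : 'M[R]_d := \matrix_(a, b)
  (partial a (partial b f) x - \sum_c christoffel G c a b x * partial c f x).

End LocalFormulas.

Record almost_contact_metric (R : realType) (d : nat) (M : smooth_manifold R d)
  := AlmostContactMetric {
  acm_phi : endo_field M;
  acm_zeta : vector_field M;
  acm_eta : one_form M;
  acm_g : riemannian_metric M;
  acm_phi2 : forall i x, img i x -> forall u : 'rV[R]_d,
    u *m acm_phi i x *m acm_phi i x =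
    - u + pairing (acm_eta i x) u *: acm_zeta i x;
  acm_eta_zeta : forall i x, img i x ->
    pairing (acm_eta i x) (acm_zeta i x) = 1;
  acm_compat : forall i x, img i x -> forall u v : 'rV[R]_d,
    bilin (acm_g i x) (u *m acm_phi i x) (v *m acm_phi i x) =
    bilin (acm_g i x) u v - pairing (acm_eta i x) u * pairing (acm_eta i x) v
}.

Section Conditions.
Variables (R : realType) (d : nat) (M : smooth_manifold R d).
Implicit Types (S : almost_contact_metric M) (g : riemannian_metric M).

(* Phi(E, F) = g(E, phi F) *)
Definition fundamental_form S (i : chart_index M) (x : 'rV[R]_d) : 'M[R]_d :=
  \matrix_(k, l) bilin (acm_g S i x) (delta_mx 0 k)
                       (delta_mx 0 l *m acm_phi S i x).

Definition almost_cokahler S : Prop :=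
  (forall i x, img i x -> forall k l, d1 (acm_eta S i) x k l = 0) /\
  (forall i x, img i x ->
     forall j k l, d2 (fundamental_form S i) x j k l = 0).

Definition killing g (Z : vector_field M) : Prop :=
  forall i x, img i x -> lie_metric (Z i) (g i) x = 0.

Definition K_almost_cokahler S : Prop :=
  almost_cokahler S /\ killing (acm_g S) (acm_zeta S).

Definition eta_einstein S (a b : R) : Prop :=
  forall i x, img i x ->
    ricci (acm_g S i) x =
    a *: acm_g S i x + b *: ((acm_eta S i x)^T *m acm_eta S i x).

(* fine m^-1 is 1/m for finite m > 0, and 0 for m = +oo *)
Definition quasi_einstein g (m : \bar R) (rho : R) : Prop :=
  (0 < m)%E /\
  exists (w : M -> R) (lambda1 : R), smooth_fun w /\
    forall i x, img i x ->
      ricci (g i) x + hessian (g i) (w \o param i) x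
      - fine (m^-1)%E *: ((d0 (w \o param i) x)^T *m d0 (w \o param i) x) =
      (rho * scalar_curvature (g i) x + lambda1) *: g i x.

End Conditions.

(* m a <> (2n - 1) b. For m = +oo this is read after division by m, that is
   a <> 0; this also is the reading in which oo a is infinite for a <> 0 and
   undefined for a = 0. *)
Definition generic_coefficients (R : realType) (n : nat) (m : \bar R) (a b : R) :=
  match m with
  | r%:E => r * a <> (2 * n%:R - 1) * b
  | _ => a <> 0
  end.

(* Main.v *)
Require Import Defs.
From mathcomp Require Import all_boot all_order all_algebra.
From mathcomp Require Import all_classical all_reals all_analysis.
From mathcomp Require Import ring lra.

(* Work in one chart and write A = nabla zeta, so that zeta is Killing iff A = 0.
   From d eta = 0 and dPhi = 0, A is self-adjoint and trace-free, and A zeta = 0.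
   The quasi-Einstein equation expresses nabla_E (grad w) as
   mu E - b eta(E) zeta + k dw(E) grad w, with k = 1/m and mu constant. Its
   antisymmetrized covariant derivative is the curvature applied to grad w;
   taking the trace, the Ricci tensor being known, gives
     (a - k ((d - 1) mu - b)) dw = (k - 1) b (zeta w) eta,   d = 2n + 1.
   Differentiating zeta w along zeta gives zeta(zeta w) = mu - b + k (zeta w)^2.
   The hypotheses on the coefficients then leave only the case dw = (zeta w) eta,
   where mu = 0, (zeta w) A = 0 and d(zeta w) = - b eta at the zeros of zeta w, so
   that A = 0 everywhere. *)

Set Implicit Arguments.
Unset Strict Implicit.
Unset Printing Implicit Defensive.

Import Order.TTheory GRing.Theory Num.Theory.
Import numFieldNormedType.Exports.

Local Open Scope classical_set_scope.
Local Open Scope ring_scope.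

(** * Symmetry of second derivatives *)

Section Schwarz.
Variables (R : realType) (V : normedModType R).
Implicit Types (f : V -> R) (u v x : V).

Lemma is_derive_line f v x (s : R) : derivable f (s *: v + x) v ->
  is_derive s 1 (fun r => f (r *: v + x)) ('D_v f (s *: v + x)).
Proof.
have E : (fun h : R => h^-1 *: (((fun r => f (r *: v + x)) \o shift s) (h *: 1) -
   f (s *: v + x))) = (fun h => h^-1 *: ((f \o shift (s *: v + x)) (h *: v) -
   f (s *: v + x))).
  apply/funext => h /=; congr (_ *: (f _ - _)).
  by rewrite scalerDl addrA -[h *: 1]/(h * 1) mulr1.
move=> df; split; first by rewrite /derivable E.
by rewrite /derive E.
Qed.

Lemma line_MVT f v x (h : R) : 0 <= h ->
  (forall s, 0 <= s <= h -> derivable f (s *: v + x) v) ->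
  exists2 s, 0 <= s <= h & f (h *: v + x) - f x = h * 'D_v f (s *: v + x).
Proof.
move=> h0 df.
have [||s] := @MVT_segment R (fun r => f (r *: v + x))
    (fun r => 'D_v f (r *: v + x)) 0 h h0.
- move=> s; rewrite in_itv /= => /andP[s0 sh].
  by apply: is_derive_line; apply: df; rewrite !ltW.
- apply: derivable_within_continuous => s; rewrite in_itv /= => sh.
  by have [] := is_derive_line (df s sh).
move=> sh /=; rewrite scale0r add0r subr0 mulrC => ->.
by exists s.
Qed.

Lemma derive_shift_arg f u v x : 'D_u (fun y => f (v + y)) x = 'D_u f (v + x).
Proof.
rewrite /derive; set F := (fun _ : R => _); set F' := (fun _ : R => _).
suff -> : F = F' by [].
by apply/funext => h; rewrite /F /F' /= addrCA.
Qed.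

Lemma derivable_shift_arg f u v x :
  derivable f (v + x) u -> derivable (fun y => f (v + y)) x u.
Proof.
rewrite /derivable; set F := (fun _ : R => _); set F' := (fun _ : R => _).
suff -> : F = F' by [].
by apply/funext => h; rewrite /F /F' /= addrCA.
Qed.

(** Two mean value theorems in a row: along [u] for the increment y |-> f (h v + y) - f y, then
    along [v] for the derivative of [f] along [u]. *)
Lemma second_difference f (U : set V) u v x (h : R) : 0 <= h ->
  (forall s t : R, 0 <= s <= h -> 0 <= t <= h -> U (s *: u + (t *: v + x))) ->
  (forall y, U y -> derivable f y u) ->
  (forall y, U y -> derivable ('D_u f) y v) ->
  exists s t, [/\ 0 <= s <= h, 0 <= t <= h &
    f (h *: u + (h *: v + x)) - f (h *: u + x) - f (h *: v + x) + f x =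
    h ^+ 2 * 'D_v ('D_u f) (s *: u + (t *: v + x))].
Proof.
move=> h0 HU du dvu.
have hh : 0 <= h <= h by rewrite h0 lexx.
have h00 : 0 <= (0 : R) <= h by rewrite h0 lexx.
have U0 (s : R) : 0 <= s <= h -> U (s *: u + x).
  by move=> sh; have := HU s 0 sh h00; rewrite scale0r add0r.
have Uh (s : R) : 0 <= s <= h -> U (h *: v + (s *: u + x)).
  by move=> sh; rewrite addrCA; apply: HU.
have [|s sh] := @line_MVT (fun y => f (h *: v + y) - f y) u x h h0.
  move=> s sh; apply: derivableB; last by apply: du; apply: U0.
  by apply: derivable_shift_arg; apply: du; apply: Uh.
rewrite deriveB; last 2 first.
- by apply: derivable_shift_arg; apply: du; apply: Uh.
- by apply: du; apply: U0.
rewrite derive_shift_arg => E.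
have [|t th] := @line_MVT ('D_u f) v (s *: u + x) h h0.
  by move=> t th; apply: dvu; rewrite addrCA; apply: HU.
move=> E2; exists s, t; split; [exact: sh|exact: th|].
rewrite E2 in E; rewrite addrCA expr2 -mulrA [s *: u + _]addrCA -E.
by rewrite opprB [RHS]addrA [RHS]addrAC.
Qed.

(** The second difference does not change when [u] and [v] are exchanged. Hence one mixed derivative
    at a point near [x] equals the other one at another such point, and continuity at [x]
    concludes. *)
Lemma second_derivative_sym f (U : set V) u v x : open U -> U x ->
  (forall y, U y -> derivable f y u) ->
  (forall y, U y -> derivable f y v) ->
  (forall y, U y -> derivable ('D_u f) y v) ->
  (forall y, U y -> derivable ('D_v f) y u) ->
  {for x, continuous ('D_v ('D_u f))} ->
  {for x, continuous ('D_u ('D_v f))} ->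
  'D_v ('D_u f) x = 'D_u ('D_v f) x.
Proof.
move=> oU Ux du dv dvu duv cvu cuv.
apply/eqP; rewrite -subr_eq0 -normr_le0; apply/ler_addgt0Pr => e e0; rewrite add0r.
have e2 : 0 < e / 2 by rewrite divr_gt0.
have /nbhs_ballP[r /= r0 rU] : nbhs x [set y | [/\ U y,
    `|'D_v ('D_u f) x - 'D_v ('D_u f) y| < e / 2 &
    `|'D_u ('D_v f) x - 'D_u ('D_v f) y| < e / 2]].
  have nU : nbhs x U by exact: open_nbhs_nbhs.
  have n1 := (cvgrPdist_lt _ _).1 cvu _ e2.
  have n2 := (cvgrPdist_lt _ _).1 cuv _ e2.
  apply: filterS3 nU (n1 _) (n2 _) => y Uy y1 y2.
  exact: And3 Uy y1 y2.
(* This length keeps the parallelogram spanned by h u and h v at [x] inside the ball of radius [r];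
   the summand 1 keeps the denominator positive when [u] and [v] vanish. *)
pose h := r / (2 * (`|u| + `|v| + 1)).
have den0 : 0 < 2 * (`|u| + `|v| + 1).
  by rewrite mulr_gt0// ltr_wpDl// addr_ge0.
have h0 : 0 < h by rewrite divr_gt0.
have hr : h * (`|u| + `|v|) < r.
  rewrite /h mulrAC ltr_pdivrMr// ltr_pM2l//.
  have := normr_ge0 u; have := normr_ge0 v; lra.
have inB (s t : R) : 0 <= s <= h -> 0 <= t <= h -> ball x r (s *: u + (t *: v + x)).
  move=> /andP[s0 sh] /andP[t0 th]; rewrite -ball_normE /ball_ /=.
  rewrite distrC addrA addrK; apply: le_lt_trans hr.
  rewrite (le_trans (ler_normD _ _))// !normrZ !ger0_norm// mulrDr.
  by rewrite lerD// ler_wpM2r.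
have [|s [t [sh th E1]]] := @second_difference f U u v x h (ltW h0) _ du dvu.
  by move=> s t sh th; have [] := rU _ (inB s t sh th).
have [|s' [t' [sh' th' E2]]] := @second_difference f U v u x h (ltW h0) _ dv duv.
  by move=> s' t' sh' th'; rewrite addrCA; have [] := rU _ (inB t' s' th' sh').
have {E1 E2} E : 'D_v ('D_u f) (s *: u + (t *: v + x)) =
    'D_u ('D_v f) (s' *: v + (t' *: u + x)).
  have h2 : h ^+ 2 != 0 by rewrite expf_neq0// gt_eqF.
  apply: (mulfI h2); apply: etrans (esym E1) (etrans _ E2).
  rewrite [h *: u + (h *: v + x)]addrCA; congr (_ + _); exact: addrAC.
have [_ H1 _] := rU _ (inB s t sh th).
have [_ _ H2] := rU _ (inB t' s' th' sh').
rewrite addrCA -E in H2; rewrite distrC in H2.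
set p := 'D_v _ x in H1 *; set q := 'D_u _ x in H2 *.
set w := 'D_v _ _ in H1 H2.
have pwq : p - q = (p - w) + (w - q) by rewrite addrA subrK.
rewrite pwq; apply/ltW; apply: le_lt_trans (ler_normD _ _) _.
by rewrite (splitr e); exact: ltrD H1 H2.
Qed.

End Schwarz.

(** * Smooth functions and matrices *)

Section SmoothFunctions.
Variables (R : realType) (d : nat) (U : set 'rV[R]_d).
Hypothesis oU : open U.
Implicit Types (f g : 'rV[R]_d -> R) (x : 'rV[R]_d).

Lemma near_on (P : set 'rV[R]_d) x :
  U x -> (forall y, U y -> P y) -> \forall y \near x, P y.
Proof.
by move=> Ux UP; apply: filterS UP _; exact: open_nbhs_nbhs.
Qed.

Lemma partial_ext k f g x : U x -> (forall y, U y -> f y = g y) ->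
  partial k f x = partial k g x.
Proof. by move=> Ux fg; apply: near_eq_derive; exact: near_on. Qed.

Lemma smooth_derivable f k x :
  smooth_on U f -> U x -> derivable f x (delta_mx 0 k).
Proof. by move=> sf Ux; have [_] := sf [::] x Ux; apply. Qed.

Lemma smooth_partial f k : smooth_on U f -> smooth_on U (partial k f).
Proof. by move=> sf s; have := sf (rcons s k); rewrite /partials foldr_rcons. Qed.

Lemma smooth_partialC f i j x : smooth_on U f -> U x ->
  partial i (partial j f) x = partial j (partial i f) x.
Proof.
move=> sf Ux; apply: (second_derivative_sym oU Ux).
- by move=> y; apply: smooth_derivable.
- by move=> y; apply: smooth_derivable.
- by move=> y; apply: (@smooth_derivable (partial j f)); exact: smooth_partial.
- by move=> y; apply: (@smooth_derivable (partial i f)); exact: smooth_partial.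
- by have [] := sf [:: i; j] x Ux.
- by have [] := sf [:: j; i] x Ux.
Qed.

Lemma partial_cst k c x : partial k (fun=> c) x = 0.
Proof. exact: derive_cst. Qed.

Lemma partialD k f g x : derivable f x (delta_mx 0 k) ->
  derivable g x (delta_mx 0 k) ->
  partial k (fun y => f y + g y) x = partial k f x + partial k g x.
Proof. exact: deriveD. Qed.

Lemma partialM k f g x : derivable f x (delta_mx 0 k) ->
  derivable g x (delta_mx 0 k) ->
  partial k (fun y => f y * g y) x = partial k f x * g x + f x * partial k g x.
Proof.
move=> df dg; rewrite /partial (deriveM df dg) addrC.
rewrite -[_ *: 'D__ f x]/(_ * _) -[_ *: 'D__ g x]/(_ * _).
by rewrite [g x * _]mulrC.
Qed.

Lemma partialMl k c f x : derivable f x (delta_mx 0 k) ->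
  partial k (fun y => c * f y) x = c * partial k f x.
Proof.
move=> df; rewrite (partialM (derivable_cst _ _ _) df).
by rewrite (_ : partial k (fun=> c) x = 0) ?mul0r ?add0r//; exact: partial_cst.
Qed.

Lemma partialV k f x : f x != 0 -> derivable f x (delta_mx 0 k) ->
  partial k (fun y => (f y)^-1) x = - 1 * ((f x)^-1 * (f x)^-1) * partial k f x.
Proof.
move=> f0 df; rewrite /partial deriveV// mulN1r -invfM.
by [].
Qed.

(* Closed under partial derivatives by the sum, product and quotient rules;
   hence its members are C^oo. *)
Inductive generated : ('rV[R]_d -> R) -> Prop :=
| gen_smooth f : smooth_on U f -> generated f
| gen_cst c : generated (fun=> c)
| genD f g : generated f -> generated g -> generated (fun x => f x + g x)
| genM f g : generated f -> generated g -> generated (fun x => f x * g x)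
| genV f : (forall x, U x -> f x != 0) -> generated f ->
    generated (fun x => (f x)^-1)
| gen_ext f g : (forall x, U x -> f x = g x) -> generated f -> generated g.

(** Both parts go through a single induction, because the partial derivative of a product or of an
    inverse is identified by means of the derivability of the factors. *)
Lemma generated_step f : generated f ->
  (forall x, U x -> {for x, continuous f} /\
     forall k : 'I_d, derivable f x (delta_mx 0 k)) /\
  forall k, generated (partial k f).
Proof.
elim=> {f}.
- move=> f sf; split; first by move=> x Ux; exact: (sf [::]).
  by move=> k; apply: gen_smooth; exact: smooth_partial.
- move=> c; split=> [x Ux|k].
    by split=> [|k]; [exact: cst_continuous|exact: derivable_cst].
  by apply: gen_ext (gen_cst 0) => x _; rewrite partial_cst.
- move=> f g gf [Hf pf] gg [Hg pg]; split=> [x Ux|k].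
    have [[cf df] [cg dg]] := (Hf x Ux, Hg x Ux).
    by split=> [|k]; [exact: continuousD|exact: derivableD].
  apply: gen_ext (genD (pf k) (pg k)) => x Ux.
  by have [[_ df] [_ dg]] := (Hf x Ux, Hg x Ux); rewrite partialD.
- move=> f g gf [Hf pf] gg [Hg pg]; split=> [x Ux|k].
    have [[cf df] [cg dg]] := (Hf x Ux, Hg x Ux).
    by split=> [|k]; [exact: continuousM|exact: derivableM].
  apply: gen_ext (genD (genM (pf k) gg) (genM gf (pg k))) => x Ux.
  by have [[_ df] [_ dg]] := (Hf x Ux, Hg x Ux); rewrite partialM.
- move=> f f0 gf [Hf pf]; split=> [x Ux|k].
    have [cf df] := Hf x Ux.
    split=> [|k]; first by apply: continuousV => //; exact: f0.
    by apply: derivableV => //; exact: f0.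
  have gV2 := genM (genV f0 gf) (genV f0 gf).
  apply: gen_ext (genM (genM (gen_cst (- 1)) gV2) (pf k)) => x Ux.
  by have [_ df] := Hf x Ux; rewrite partialV//; exact: f0.
- move=> f g fg gf [Hf pf]; split=> [x Ux|k].
    have [cf df] := Hf x Ux; split=> [|k].
      suff : g @ x --> g x by [].
      rewrite -(fg x Ux); apply: cvg_trans cf.
      apply: (@near_eq_cvg _ _ (nbhs x) _ f g).
      exact: (@near_on (fun y => f y = g y) x Ux fg).
    by apply: near_eq_derivable (df k); exact: (@near_on (fun y => f y = g y) x Ux fg).
  by apply: gen_ext (pf k) => x Ux; exact: partial_ext.
Qed.

Lemma generated_smooth f : generated f -> smooth_on U f.
Proof.
move=> gf s x Ux; have gs : generated (partials s f).
  by elim: s => //= k s IH; have [_] := generated_step IH; apply.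
by have [H _] := generated_step gs; exact: H.
Qed.

Lemma smooth_ext f g :
  (forall x, U x -> f x = g x) -> smooth_on U f -> smooth_on U g.
Proof. by move=> fg /gen_smooth sf; apply/generated_smooth/(gen_ext fg). Qed.

Lemma smooth_cst c : smooth_on U (fun=> c).
Proof. exact/generated_smooth/gen_cst. Qed.

Lemma smoothD f g : smooth_on U f -> smooth_on U g ->
  smooth_on U (fun x => f x + g x).
Proof. by move=> /gen_smooth ? /gen_smooth ?; exact/generated_smooth/genD. Qed.

Lemma smoothM f g : smooth_on U f -> smooth_on U g ->
  smooth_on U (fun x => f x * g x).
Proof. by move=> /gen_smooth ? /gen_smooth ?; exact/generated_smooth/genM. Qed.

Lemma smoothV f : (forall x, U x -> f x != 0) -> smooth_on U f ->
  smooth_on U (fun x => (f x)^-1).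
Proof. by move=> f0 /gen_smooth ?; exact/generated_smooth/genV. Qed.

Lemma smoothN f : smooth_on U f -> smooth_on U (fun x => - f x).
Proof.
move=> sf; apply: smooth_ext (smoothM (smooth_cst (- 1)) sf) => x _.
by rewrite mulN1r.
Qed.

Lemma smooth_sum (I : Type) (r : seq I) (P : pred I) (F : I -> 'rV[R]_d -> R) :
  (forall i, smooth_on U (F i)) ->
  smooth_on U (fun x => \sum_(i <- r | P i) F i x).
Proof.
move=> sF; elim: r => [|i r IH].
  by apply: smooth_ext (smooth_cst 0) => x _; rewrite big_nil.
case Pi : (P i); last by apply: smooth_ext IH => x _; rewrite big_cons Pi.
by apply: smooth_ext (smoothD (sF i) IH) => x _; rewrite big_cons Pi.
Qed.

Lemma smooth_prod (I : Type) (r : seq I) (P : pred I) (F : I -> 'rV[R]_d -> R) :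
  (forall i, smooth_on U (F i)) ->
  smooth_on U (fun x => \prod_(i <- r | P i) F i x).
Proof.
move=> sF; elim: r => [|i r IH].
  by apply: smooth_ext (smooth_cst 1) => x _; rewrite big_nil.
case Pi : (P i); last by apply: smooth_ext IH => x _; rewrite big_cons Pi.
by apply: smooth_ext (smoothM (sF i) IH) => x _; rewrite big_cons Pi.
Qed.

Lemma partial_sum k n (F : 'I_n -> 'rV[R]_d -> R) x :
  (forall i, smooth_on U (F i)) -> U x ->
  partial k (fun y => \sum_i F i y) x = \sum_i partial k (F i) x.
Proof.
move=> sF Ux; have -> : (fun y => \sum_i F i y) = \sum_i F i.
  by apply/funext => y; rewrite fct_sumE.
by rewrite /partial derive_sum// => i; exact: smooth_derivable.
Qed.

(** * Calculus of matrix-valued functions *)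

Definition smooth_mx p q (X : 'rV[R]_d -> 'M[R]_(p, q)) : Prop :=
  forall i j, smooth_on U (fun x => X x i j).

Definition partial_mx p q (k : 'I_d) (X : 'rV[R]_d -> 'M[R]_(p, q)) x :=
  \matrix_(i, j) partial k (fun y => X y i j) x.

Lemma partial_mxE p q k (X : 'rV[R]_d -> 'M[R]_(p, q)) x i j :
  partial_mx k X x i j = partial k (fun y => X y i j) x.
Proof. exact: mxE. Qed.

Lemma smooth_mx_ext p q (X Y : 'rV[R]_d -> 'M[R]_(p, q)) :
  (forall x, U x -> X x = Y x) -> smooth_mx X -> smooth_mx Y.
Proof. by move=> XY sX i j; apply: smooth_ext (sX i j) => x /XY ->. Qed.

Lemma smooth_mx_cst p q (A : 'M[R]_(p, q)) : smooth_mx (fun=> A).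
Proof. by move=> i j; exact: smooth_cst. Qed.

Lemma smooth_mxD p q (X Y : 'rV[R]_d -> 'M[R]_(p, q)) :
  smooth_mx X -> smooth_mx Y -> smooth_mx (fun x => X x + Y x).
Proof.
by move=> sX sY i j; apply: smooth_ext (smoothD (sX i j) (sY i j)) => x _; rewrite mxE.
Qed.

Lemma smooth_mxZ p q f (X : 'rV[R]_d -> 'M[R]_(p, q)) :
  smooth_on U f -> smooth_mx X -> smooth_mx (fun x => f x *: X x).
Proof.
by move=> sf sX i j; apply: smooth_ext (smoothM sf (sX i j)) => x _; rewrite mxE.
Qed.

Lemma smooth_mxM p q r (X : 'rV[R]_d -> 'M[R]_(p, q)) (Y : 'rV[R]_d -> 'M[R]_(q, r)) :
  smooth_mx X -> smooth_mx Y -> smooth_mx (fun x => X x *m Y x).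
Proof.
move=> sX sY i j; have : smooth_on U (fun x => \sum_k X x i k * Y x k j).
  by apply: smooth_sum => k; exact: smoothM.
by apply: smooth_ext => x _; rewrite mxE.
Qed.

Lemma smooth_mxT p q (X : 'rV[R]_d -> 'M[R]_(p, q)) :
  smooth_mx X -> smooth_mx (fun x => (X x)^T).
Proof. by move=> sX i j; apply: smooth_ext (sX j i) => x _; rewrite mxE. Qed.

Lemma smooth_det n (X : 'rV[R]_d -> 'M[R]_n) :
  smooth_mx X -> smooth_on U (fun x => \det (X x)).
Proof.
move=> sX; rewrite /determinant; apply: smooth_sum => s.
by apply: smoothM; [exact: smooth_cst|apply: smooth_prod].
Qed.

(** Cramer's rule: the inverse is the adjugate, whose entries are cofactors, divided by a
    determinant without zeros on [U]. *)
Lemma smooth_invmx n (X : 'rV[R]_d -> 'M[R]_n) : smooth_mx X ->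
  (forall x, U x -> X x \in unitmx) -> smooth_mx (fun x => invmx (X x)).
Proof.
move=> sX uX i j; have sadj : smooth_on U (fun x => \adj (X x) i j).
  apply: (@smooth_ext (fun x => cofactor (X x) j i)).
    by move=> x _; rewrite mxE.
  rewrite /cofactor; apply: smoothM; first exact: smooth_cst.
  apply: smooth_det => k l.
  by apply: smooth_ext (sX (lift j k) (lift i l)) => x _; rewrite !mxE.
have sdet : smooth_on U (fun x => (\det (X x))^-1).
  apply: smoothV; last exact: smooth_det.
  by move=> x /uX; rewrite unitmxE unitfE.
apply: smooth_ext (smoothM sdet sadj) => x Ux.
by rewrite /invmx uX// [RHS]mxE.
Qed.

Lemma smooth_partial_mx p q k (X : 'rV[R]_d -> 'M[R]_(p, q)) :
  smooth_mx X -> smooth_mx (partial_mx k X).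
Proof.
move=> sX i j; apply: smooth_ext (smooth_partial k (sX i j)) => x _.
by rewrite mxE.
Qed.

Lemma partial_mx_ext p q k (X Y : 'rV[R]_d -> 'M[R]_(p, q)) x : U x ->
  (forall y, U y -> X y = Y y) -> partial_mx k X x = partial_mx k Y x.
Proof.
move=> Ux XY; apply/matrixP => i j; rewrite !mxE.
by apply: partial_ext => // y /XY ->.
Qed.

Lemma partial_mx_cst p q k (A : 'M[R]_(p, q)) x : partial_mx k (fun=> A) x = 0.
Proof. by apply/matrixP => i j; rewrite !mxE partial_cst. Qed.

Lemma partial_mxD p q k (X Y : 'rV[R]_d -> 'M[R]_(p, q)) x :
  smooth_mx X -> smooth_mx Y -> U x ->
  partial_mx k (fun y => X y + Y y) x = partial_mx k X x + partial_mx k Y x.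
Proof.
move=> sX sY Ux; apply/matrixP => i j; rewrite [RHS]mxE !partial_mxE.
rewrite -(partialD (smooth_derivable (sX i j) Ux) (smooth_derivable (sY i j) Ux)).
by apply: partial_ext Ux _ => y _; rewrite mxE.
Qed.

Lemma partial_mxZ p q k f (X : 'rV[R]_d -> 'M[R]_(p, q)) x :
  smooth_on U f -> smooth_mx X -> U x ->
  partial_mx k (fun y => f y *: X y) x =
  partial k f x *: X x + f x *: partial_mx k X x.
Proof.
move=> sf sX Ux; apply/matrixP => i j.
rewrite partial_mxE [RHS]mxE 2![in RHS]mxE partial_mxE.
rewrite -(partialM (smooth_derivable sf Ux) (smooth_derivable (sX i j) Ux)).
by apply: partial_ext Ux _ => y _; rewrite mxE.
Qed.

Lemma partial_mxM p q r k (X : 'rV[R]_d -> 'M[R]_(p, q))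
    (Y : 'rV[R]_d -> 'M[R]_(q, r)) x :
  smooth_mx X -> smooth_mx Y -> U x ->
  partial_mx k (fun y => X y *m Y y) x =
  partial_mx k X x *m Y x + X x *m partial_mx k Y x.
Proof.
move=> sX sY Ux; apply/matrixP => i j.
rewrite partial_mxE [RHS]mxE 2![in RHS]mxE -big_split /=.
transitivity (partial k (fun y => \sum_l X y i l * Y y l j) x).
  by apply: partial_ext => // y _; rewrite mxE.
rewrite partial_sum//; last by move=> l; exact: smoothM.
apply: eq_bigr => l _; rewrite !partial_mxE.
exact: partialM (smooth_derivable (sX i l) Ux) (smooth_derivable (sY l j) Ux).
Qed.

Lemma partial_mxT p q k (X : 'rV[R]_d -> 'M[R]_(p, q)) x :
  partial_mx k (fun y => (X y)^T) x = (partial_mx k X x)^T.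
Proof.
apply/matrixP => i j; rewrite [RHS]mxE !partial_mxE; congr (partial _ _ _).
by apply/funext => y; rewrite mxE.
Qed.

Lemma partial_mxC p q i j (X : 'rV[R]_d -> 'M[R]_(p, q)) x :
  smooth_mx X -> U x ->
  partial_mx i (partial_mx j X) x = partial_mx j (partial_mx i X) x.
Proof.
move=> sX Ux; apply/matrixP => k l.
have E a b : partial_mx a (partial_mx b X) x k l =
    partial a (partial b (fun y => X y k l)) x.
  apply: etrans (partial_mxE _ _ _ _ _) _.
  by apply: partial_ext Ux _ => y _; exact: partial_mxE.
apply: etrans (E i j) (etrans _ (esym (E j i))).
exact: smooth_partialC (sX k l) Ux.
Qed.

End SmoothFunctions.

(** * Levi-Civita connection in coordinates *)

(* Otherwise unification compares two partial derivatives as limits. *)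
#[local] Opaque partial partial_mx.

Section Connection.
Variables (R : realType) (d : nat) (U : set 'rV[R]_d).
Hypothesis oU : open U.
Variable G : 'rV[R]_d -> 'M[R]_d.
Hypothesis smooth_G : smooth_mx U G.
Hypothesis G_sym : forall x, U x -> (G x)^T = G x.
Hypothesis G_unit : forall x, U x -> G x \in unitmx.
Implicit Types (v w : 'rV[R]_d -> 'rV[R]_d) (x : 'rV[R]_d).

(* Tangent vectors are rows, so nabla_a v = partial_a v + v *m Gam a. *)
Definition Gam (a : 'I_d) x : 'M[R]_d := \matrix_(k, l) christoffel G l a k x.

(** Twice the Christoffel symbols of the first kind: entry (k, l) is 2 g(nabla_a d_k, d_l). *)
Definition koszul (a : 'I_d) x : 'M[R]_d :=
  \matrix_(k, l) (partial a (fun y => G y k l) x + partial k (fun y => G y a l) x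
     - partial l (fun y => G y a k) x).

Lemma partial_G_sym k i j x : U x ->
  partial k (fun y => G y i j) x = partial k (fun y => G y j i) x.
Proof.
move=> Ux; apply: (partial_ext oU _ Ux) => y Uy.
by rewrite -[in RHS](G_sym Uy) mxE.
Qed.

Lemma Gam_entry a x k l : Gam a x k l = christoffel G l a k x.
Proof. exact: mxE. Qed.

Lemma GamE a x : U x -> Gam a x = (2^-1 *: koszul a x) *m invmx (G x).
Proof.
move=> Ux; apply/matrixP => k l; rewrite mxE /christoffel -scalemxAl.
rewrite [RHS]mxE [X in _ = _ * X]mxE; congr (_ * _); apply: eq_bigr => j _.
rewrite mulrC; congr (_ * _); first by rewrite mxE.
by rewrite -{2}(G_sym Ux) -trmx_inv mxE.
Qed.

(** The metric is parallel: in the sum of half of [koszul a x] and its transpose, only the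
    derivative of [G] in direction [a] survives. *)
Lemma Gam_metric a x : U x ->
  partial_mx a G x = Gam a x *m G x + G x *m (Gam a x)^T.
Proof.
move=> Ux; have GG : Gam a x *m G x = 2^-1 *: koszul a x.
  by rewrite GamE// mulmxKV// G_unit.
have -> : G x *m (Gam a x)^T = (Gam a x *m G x)^T by rewrite trmx_mul G_sym.
have E i j : (2^-1 *: koszul a x) i j = 2^-1 *
    (partial a (fun y => G y i j) x + partial i (fun y => G y a j) x
     - partial j (fun y => G y a i) x) by rewrite mxE; congr (_ * _); rewrite mxE.
rewrite GG; apply/matrixP => k l; rewrite partial_mxE [RHS]mxE [X in _ + X]mxE !E.
rewrite (partial_G_sym a l k Ux).
by field.
Qed.

(** Absence of torsion, read off from the symmetry of the Koszul expression in [a] and [b]. *)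
Lemma Gam_sym a b l x : U x -> Gam a x b l = Gam b x a l.
Proof.
move=> Ux; rewrite !mxE /christoffel; congr (_ * _); apply: eq_bigr => j _.
congr (_ * _); rewrite (partial_G_sym j a b Ux).
by congr (_ - _); exact: addrC.
Qed.

Lemma smooth_invG : smooth_mx U (fun x => invmx (G x)).
Proof. exact: smooth_invmx. Qed.

Lemma smooth_Gam a : smooth_mx U (Gam a).
Proof.
have s1 i j k : smooth_on U (partial i (fun y => G y j k)).
  exact: smooth_partial.
have : smooth_mx U (fun x => (2^-1 *: koszul a x) *m invmx (G x)).
  apply: (smooth_mxM oU _ smooth_invG).
  apply: (smooth_mxZ oU (smooth_cst oU _)).
  move=> k l; apply: (smooth_ext oU) (smoothD oU (smoothD oU (s1 a k l) (s1 k a l))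
     (smoothN oU (s1 l a k))) => x _.
  by rewrite mxE.
by apply: smooth_mx_ext => // x Ux; rewrite GamE.
Qed.

#[local] Opaque Gam christoffel.

Definition nab (a : 'I_d) v x : 'rV[R]_d := partial_mx a v x + v x *m Gam a x.

(** The dual connection on 1-forms; sign and transpose are those that give the Leibniz rule
    [partial_pairing]. *)
Definition conab (a : 'I_d) w x : 'rV[R]_d :=
  partial_mx a w x - w x *m (Gam a x)^T.

Lemma smooth_nab a v : smooth_mx U v -> smooth_mx U (nab a v).
Proof.
move=> sv; apply: (smooth_mxD oU); first exact: smooth_partial_mx.
exact: (smooth_mxM oU sv (smooth_Gam a)).
Qed.

Lemma nab_ext a v w x : U x -> (forall y, U y -> v y = w y) ->
  nab a v x = nab a w x.
Proof.
by move=> Ux vw; rewrite /nab (partial_mx_ext oU a Ux vw) vw.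
Qed.

Lemma nabD a v w x : smooth_mx U v -> smooth_mx U w -> U x ->
  nab a (fun y => v y + w y) x = nab a v x + nab a w x.
Proof.
by move=> sv sw Ux; rewrite /nab (partial_mxD oU a sv sw Ux) mulmxDl addrACA.
Qed.

Lemma nabZ a f v x : smooth_on U f -> smooth_mx U v -> U x ->
  nab a (fun y => f y *: v y) x = partial a f x *: v x + f x *: nab a v x.
Proof.
move=> sf sv Ux; rewrite /nab (partial_mxZ oU a sf sv Ux) scalerDr scalemxAl.
by rewrite addrA.
Qed.

Lemma nab_cst a (v : 'rV[R]_d) x : nab a (fun=> v) x = v *m Gam a x.
Proof. by rewrite /nab partial_mx_cst add0r. Qed.

(** Since the metric is parallel, lowering an index commutes with covariant differentiation. *)
Lemma conab_lower a v w x : smooth_mx U v -> U x ->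
  (forall y, U y -> w y = v y *m G y) -> conab a w x = nab a v x *m G x.
Proof.
move=> sv Ux wE; rewrite /conab wE// (partial_mx_ext oU a Ux wE).
rewrite (partial_mxM oU a sv smooth_G Ux) Gam_metric// /nab mulmxDl mulmxDr.
by rewrite !mulmxA addrA addrK.
Qed.

Lemma conab_entry a w x b : conab a w x 0 b =
  partial a (fun y => w y 0 b) x - \sum_c w x 0 c * Gam a x b c.
Proof.
rewrite [LHS]mxE partial_mxE [X in _ + X]mxE [X in - X]mxE; congr (_ - _).
by apply: eq_bigr => c _; rewrite mxE.
Qed.

(** Together with [conab_lower], this turns an equation for the Hessian into one for the covariant
    derivative of the gradient. *)
Lemma conab_hessian f a x : conab a (d0 f) x = row a (hessian G f x).
Proof.
apply/rowP => b; rewrite conab_entry [RHS]mxE [RHS]mxE; congr (_ - _).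
  apply: (f_equal (fun h => partial a h x)).
  by apply/funext => y; exact: mxE.
by apply: eq_bigr => c _; rewrite mxE Gam_entry mulrC.
Qed.

Lemma partial_pairing a w v x : smooth_mx U w -> smooth_mx U v -> U x ->
  partial_mx a (fun y => w y *m (v y)^T) x =
  conab a w x *m (v x)^T + w x *m (nab a v x)^T.
Proof.
move=> sw sv Ux; rewrite (partial_mxM oU a sw (smooth_mxT oU sv) Ux) partial_mxT.
rewrite /conab /nab linearD /= trmx_mul mulmxBl mulmxDr !mulmxA.
by rewrite [_ + w x *m _ *m _]addrC addrA subrK.
Qed.

(* R(d_a, d_b) acts on tangent vectors as right multiplication by curv a b. *)
Definition curv (a b : 'I_d) x : 'M[R]_d :=
  partial_mx a (Gam b) x - partial_mx b (Gam a) x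
  + (Gam b x *m Gam a x - Gam a x *m Gam b x).

Lemma riemann_curv a b c l x : riemann G a b c l x = curv a b x c l.
Proof.
have E (A B C D : 'M[R]_d) i j :
  (A - B + (C - D)) i j = A i j - B i j + (C i j - D i j) by rewrite !mxE.
have P i j : partial_mx i (Gam j) x c l = partial i (christoffel G l j c) x.
  apply: etrans (partial_mxE _ _ _ _ _) _.
  apply: (f_equal (fun f => partial i f x)).
  by apply/funext => y; exact: Gam_entry.
apply: etrans _ (esym (E _ _ _ _ _ _)).
apply: (f_equal2 +%R).
  exact: (f_equal2 (fun u v : R => u - v) (esym (P a b)) (esym (P b a))).
rewrite [X in _ = X - _]mxE [X in _ = _ - X]mxE -sumrB.
apply: eq_bigr => k _; rewrite !Gam_entry.
by rewrite [X in X - _]mulrC [X in _ - X]mulrC.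
Qed.

(** Second derivatives of [v] commute and the terms with first derivatives cancel in pairs.
    Coordinate fields commute, so there is no bracket term. *)
Lemma nab_comm a b v x : smooth_mx U v -> U x ->
  nab a (nab b v) x - nab b (nab a v) x = v x *m curv a b x.
Proof.
move=> sv Ux.
have E a' b' : nab a' (nab b' v) x =
    partial_mx a' (partial_mx b' v) x + (partial_mx a' v x *m Gam b' x +
      v x *m partial_mx a' (Gam b') x) +
    (partial_mx b' v x *m Gam a' x + v x *m Gam b' x *m Gam a' x).
  have s1 := smooth_partial_mx oU b' sv.
  have s2 := smooth_mxM oU sv (smooth_Gam b').
  rewrite {1}/nab (partial_mxD oU a' s1 s2 Ux).
  by rewrite (partial_mxM oU a' sv (smooth_Gam b') Ux) /nab mulmxDl.
have alg (p1 p2 p3 p4 p5 p6 p7 : 'rV[R]_d) :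
    p1 + (p2 + p3) + (p4 + p6) - (p1 + (p4 + p5) + (p2 + p7)) =
    p3 - p5 + (p6 - p7) by apply/rowP => k; rewrite !mxE; ring.
apply: etrans (f_equal2 (fun p q => p - q) (E a b) (E b a)) _.
rewrite (partial_mxC oU b a sv Ux); apply: etrans (alg _ _ _ _ _ _ _) _.
by rewrite /curv mulmxDr !mulmxBr !mulmxA.
Qed.

Lemma ricci_contract (v : 'rV[R]_d) a x :
  \sum_e (v *m curv e a x) 0 e = (ricci G x *m v^T) a 0.
Proof.
rewrite [RHS]mxE.
transitivity (\sum_e \sum_c riemann G e a c e x * v 0 c).
  apply: eq_bigr => e _; rewrite mxE; apply: eq_bigr => c _.
  by rewrite mulrC riemann_curv.
rewrite exchange_big /=; apply: eq_bigr => c _.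
by rewrite !mxE mulr_suml.
Qed.

End Connection.

(** * Almost co-Kähler structures *)

Section ContactAlgebra.
Variables (R : fieldType) (d : nat) (z e : 'rV[R]_d) (P G : 'M[R]_d).
Hypothesis P2 : P *m P = e^T *m z - 1%:M.
Hypothesis ez : z *m e^T = 1%:M.
Hypothesis PG : P *m G *m P^T = G - e^T *m e.

(** Since phi^2 zeta = 0, applying the formula for phi^2 to phi zeta gives phi zeta = s zeta with s
    = eta(phi zeta). Then s^2 = 0, so s = 0. *)
Lemma contact_zP : z *m P = 0.
Proof.
have yP : z *m P *m P = 0.
  by rewrite -mulmxA P2 mulmxBr mulmxA ez mul1mx mulmx1 subrr.
set s := z *m P *m e^T.
have yE : z *m P = s *m z.
  have : z *m P *m (P *m P) = 0 by rewrite mulmxA yP mul0mx.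
  by rewrite P2 mulmxBr mulmx1 mulmxA => /eqP; rewrite subr_eq0 => /eqP <-.
have ss : s *m s = 0.
  by rewrite {2}/s mulmxA [s *m (z *m P)]mulmxA -yE yP mul0mx.
suff -> : z *m P = 0 by [].
rewrite yE; suff -> : s = 0 by rewrite mul0mx.
move: ss; rewrite [s]mx11_scalar -scalar_mxM => /matrixP/(_ 0 0).
rewrite !mxE eqxx mulr1n => /eqP.
by rewrite mulf_eq0 orbb => /eqP ->; apply/matrixP => i j; rewrite !mxE mul0rn.
Qed.

(** Computing phi^3 as phi^2 phi and as phi phi^2, with phi zeta = 0, gives (eta o phi) zeta = 0;
    pairing with eta concludes. *)
Lemma contact_Pe : P *m e^T = 0.
Proof.
have H : P *m e^T *m z = 0.
  have : P *m (P *m P) = P *m P *m P by rewrite mulmxA.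
  rewrite P2 mulmxBr mulmxBl mulmx1 mul1mx -[e^T *m z *m P]mulmxA contact_zP.
  by rewrite mulmx0 mulmxA => /eqP; rewrite -subr_eq0 opprB addrA subrK subr0 => /eqP.
by rewrite -[P *m e^T]mulmx1 -ez mulmxA H mul0mx.
Qed.

Lemma contact_zG : z *m G = e.
Proof.
apply/eqP; rewrite -subr_eq0; apply/eqP.
rewrite -[X in _ - X]mul1mx -ez -[_ *m e^T *m e]mulmxA -mulmxBr -PG.
by rewrite !mulmxA contact_zP !mul0mx.
Qed.

(** Multiply the compatibility condition by [P] on the left and expand [P *m P]; the terms in [e]
    vanish by [contact_Pe]. *)
Lemma contact_skew : G *m P^T = - (P *m G).
Proof.
have : P *m (P *m G *m P^T) = P *m (G - e^T *m e) by rewrite PG.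
rewrite mulmxBr [P *m (e^T *m e)]mulmxA contact_Pe mul0mx subr0 => <-.
rewrite !mulmxA P2 !mulmxBl mul1mx -[e^T *m z *m G]mulmxA contact_zG.
have eP : e *m P^T = 0 by rewrite -[e]trmxK -trmx_mul contact_Pe trmx0.
by rewrite -[e^T *m e *m P^T]mulmxA eP mulmx0 sub0r opprK.
Qed.

End ContactAlgebra.

Lemma sum_mul_delta (R : pzRingType) (d : nat) (v : 'I_d -> R) k :
  \sum_j v j * (k == j)%:R = v k.
Proof.
rewrite (bigD1 k)//= eqxx mulr1 big1 ?addr0// => j /negPf.
by rewrite eq_sym => ->; rewrite mulr0.
Qed.

Section AlmostCokahler.
Variables (R : realType) (d : nat) (U : set 'rV[R]_d).
Hypothesis oU : open U.
Variable G : 'rV[R]_d -> 'M[R]_d.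
Hypothesis smooth_G : smooth_mx U G.
Hypothesis G_sym : forall x, U x -> (G x)^T = G x.
Hypothesis G_unit : forall x, U x -> G x \in unitmx.
Variables (Z e : 'rV[R]_d -> 'rV[R]_d) (P : 'rV[R]_d -> 'M[R]_d).
Hypotheses (smooth_Z : smooth_mx U Z) (smooth_e : smooth_mx U e)
  (smooth_P : smooth_mx U P).
Hypothesis P2 : forall x, U x -> P x *m P x = (e x)^T *m Z x - 1%:M.
Hypothesis eZ : forall x, U x -> Z x *m (e x)^T = 1%:M.
Hypothesis PGP : forall x, U x ->
  P x *m G x *m (P x)^T = G x - (e x)^T *m e x.
Hypothesis closed_e : forall x k l, U x -> d1 e x k l = 0.
Hypothesis closed_F : forall x j k l, U x ->
  d2 (fun y => G y *m (P y)^T) x j k l = 0.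

(** * The covariant derivative of zeta *)

(* Row a is nabla_a zeta, so that zeta is Killing as soon as shape vanishes. *)
Definition shape x : 'M[R]_d := \matrix_(a, l) nab G a Z x 0 l.

Lemma row_shape a x : row a (shape x) = nab G a Z x.
Proof. by apply/rowP => l; rewrite !mxE. Qed.

Lemma ZG x : U x -> Z x *m G x = e x.
Proof. by move=> Ux; exact: contact_zG (P2 Ux) (eZ Ux) (PGP Ux). Qed.

Lemma GZ x : U x -> G x *m (Z x)^T = (e x)^T.
Proof. by move=> Ux; rewrite -(ZG Ux) trmx_mul G_sym. Qed.

Lemma nab_Z_lower a x : U x -> nab G a Z x *m G x = conab G a e x.
Proof.
move=> Ux; rewrite (conab_lower oU smooth_G G_sym G_unit a smooth_Z Ux)//.
by move=> y Uy; rewrite ZG.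
Qed.

(** The field zeta has constant length: differentiating eta(zeta) = 1 gives two terms, which are
    equal because eta is the metric dual of zeta. *)
Lemma nab_Z_e a x : U x -> nab G a Z x *m (e x)^T = 0.
Proof.
move=> Ux; have : partial_mx a (fun y => e y *m (Z y)^T) x = 0.
  rewrite (partial_mx_ext oU (Y := fun=> 1%:M) a Ux) ?partial_mx_cst// => y Uy.
  by rewrite -[e y]trmxK -trmx_mul eZ// trmx1.
rewrite (partial_pairing oU G a smooth_e smooth_Z Ux) -nab_Z_lower//.
rewrite -mulmxA GZ//.
have -> : e x *m (nab G a Z x)^T = (nab G a Z x *m (e x)^T)^T.
  by rewrite trmx_mul trmxK.
set s := nab G a Z x *m (e x)^T => /matrixP/(_ 0 0).
rewrite mxE [X in _ + X]mxE [RHS]mxE => /eqP; rewrite -mulr2n mulrn_eq0 /= => /eqP s0.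
by apply/matrixP => i j; rewrite !ord1 s0 mxE.
Qed.

Lemma shape_e x : U x -> shape x *m (e x)^T = 0.
Proof.
by move=> Ux; apply/row_matrixP => a; rewrite row_mul row_shape nab_Z_e// row0.
Qed.

Lemma shapeG_entry a b x : U x -> (shape x *m G x) a b = conab G a e x 0 b.
Proof. by move=> Ux; rewrite -nab_Z_lower// -row_shape -row_mul [RHS]mxE. Qed.

(** For a torsion-free connection, d eta = 0 says that nabla eta is symmetric. *)
Lemma shapeG_sym x : U x -> (shape x *m G x)^T = shape x *m G x.
Proof.
move=> Ux; apply/matrixP => b a; rewrite mxE !shapeG_entry//.
apply: etrans (conab_entry G a e x b) (etrans _ (esym (conab_entry G b e x a))).
apply: (f_equal2 (fun u v : R => u - v)).
  by apply/eqP; rewrite -subr_eq0; apply/eqP; exact: closed_e.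
by apply: eq_bigr => c _; rewrite (Gam_sym oU G_sym a b c Ux).
Qed.

(** Self-adjointness converts eta(nabla zeta) = 0 into nabla_zeta zeta = 0. *)
Lemma Z_shape x : U x -> Z x *m shape x = 0.
Proof.
move=> Ux; rewrite -[shape x](mulmxK (G_unit Ux)) mulmxA.
rewrite -shapeG_sym// -[Z x]trmxK -trmx_mul.
by rewrite -[shape x *m _ *m _]mulmxA GZ// shape_e// trmx0 mul0mx.
Qed.

(** Differentiates components only; the terms in [jac_Z] complete it to the Lie derivative along
    zeta. *)
Definition along_Z (X : 'rV[R]_d -> 'M[R]_d) x : 'M[R]_d :=
  \sum_j Z x 0 j *: partial_mx j X x.

Definition jac_Z x : 'M[R]_d := \matrix_(k, j) partial k (fun y => Z y 0 j) x.

Lemma row_jac_Z k x : row k (jac_Z x) = partial_mx k Z x.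
Proof. by apply/rowP => j; rewrite [LHS]mxE mxE partial_mxE. Qed.

Lemma jac_Z_shape x : U x ->
  jac_Z x = shape x - \matrix_(k, l) (Z x *m Gam G k x) 0 l.
Proof.
move=> Ux; apply/row_matrixP => k; rewrite row_jac_Z linearB /= row_shape.
have -> : row k (\matrix_(i, l) (Z x *m Gam G i x) 0 l) = Z x *m Gam G k x.
  by apply/rowP => l; rewrite [LHS]mxE mxE.
by rewrite /nab addrK.
Qed.

(** By [Gam_sym], contracting zeta with either lower index of the Christoffel symbols gives the same
    matrix, namely the one occurring in [jac_Z_shape]. *)
Lemma along_Z_G x : U x ->
  along_Z G x = (\matrix_(k, l) (Z x *m Gam G k x) 0 l) *m G x +
    G x *m (\matrix_(k, l) (Z x *m Gam G k x) 0 l)^T.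
Proof.
move=> Ux; set W := \matrix_(k, l) _.
have -> : W = \sum_j Z x 0 j *: Gam G j x.
  apply/matrixP => k l; rewrite [LHS]mxE [LHS]mxE summxE.
  by apply: eq_bigr => j _; rewrite [RHS]mxE (Gam_sym oU G_sym _ _ _ Ux).
rewrite /along_Z linear_sum /= mulmx_suml mulmx_sumr -big_split /=.
apply: eq_bigr => j _; rewrite (Gam_metric oU G_sym G_unit j Ux) scalerDr.
by rewrite linearZ /= -scalemxAl -scalemxAr.
Qed.

(** The left side is L_zeta g. Its Christoffel terms cancel, and the two terms that remain agree by
    [shapeG_sym]. *)
Lemma lie_G x : U x -> along_Z G x + jac_Z x *m G x + G x *m (jac_Z x)^T =
  shape x *m G x + shape x *m G x.
Proof.
move=> Ux; rewrite along_Z_G// jac_Z_shape//; set W := \matrix_(k, l) _.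
rewrite linearB /= mulmxBl mulmxBr.
have -> : G x *m (shape x)^T = shape x *m G x.
  by rewrite -{1}(G_sym Ux) -trmx_mul shapeG_sym.
have alg (p q r : 'M[R]_d) : p + q + (r - p) + (r - q) = r + r.
  by apply/matrixP => i j; rewrite !mxE; ring.
exact: alg.
Qed.

Lemma lie_metricE x : U x -> lie_metric Z G x =
  along_Z G x + jac_Z x *m G x + G x *m (jac_Z x)^T.
Proof.
move=> Ux; apply/matrixP => k l; rewrite [LHS]mxE !big_split /=.
have E (A B C : 'M[R]_d) i j : (A + B + C) i j = A i j + B i j + C i j.
  by rewrite !mxE.
rewrite E; congr (_ + _ + _).
- rewrite summxE; apply: eq_bigr => j _.
  by rewrite [RHS]mxE; congr (_ * _); rewrite partial_mxE.
- by rewrite [RHS]mxE; apply: eq_bigr => j _; rewrite [X in _ = X * _]mxE mulrC.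
- rewrite [RHS]mxE; apply: eq_bigr => j _.
  by rewrite [X in _ = _ * X]mxE [X in _ = _ * X]mxE.
Qed.

(** The matrix of the fundamental form; the transpose appears because [P] acts on rows. *)
Let F x := G x *m (P x)^T.

Lemma smooth_F : smooth_mx U F.
Proof. exact: (smooth_mxM oU smooth_G (smooth_mxT oU smooth_P)). Qed.

Lemma F_skew x : U x -> (F x)^T = - F x.
Proof.
move=> Ux; rewrite /F trmx_mul trmxK G_sym//.
by rewrite (contact_skew (P2 Ux) (eZ Ux) (PGP Ux)) opprK.
Qed.

Lemma FZ x : U x -> F x *m (Z x)^T = 0.
Proof.
move=> Ux; rewrite /F -mulmxA -trmx_mul.
by rewrite (contact_zP (P2 Ux) (eZ Ux)) trmx0 mulmx0.
Qed.

Lemma ZF x : U x -> Z x *m F x = 0.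
Proof.
move=> Ux; rewrite -[F x]trmxK -[Z x]trmxK -trmx_mul F_skew//.
by rewrite mulNmx FZ// oppr0 trmx0.
Qed.

(* Cartan's formula: L_zeta Phi = i_zeta dPhi + d (i_zeta Phi), and i_zeta Phi = 0. *)
Lemma lie_F x : U x -> along_Z F x + jac_Z x *m F x + F x *m (jac_Z x)^T = 0.
Proof.
move=> Ux.
(* Differentiating [FZ] here, and [ZF] in [h2], trades two of the three terms of dPhi contracted
   with zeta for derivatives of zeta. *)
have h1 k l : \sum_j Z x 0 j * partial k (fun y => F y l j) x =
    - (F x *m (jac_Z x)^T) l k.
  have : partial_mx k (fun y => F y *m (Z y)^T) x l 0 = 0.
    by rewrite (partial_mx_ext oU (Y := fun=> 0) k Ux) ?partial_mx_cst ?mxE// => y /FZ.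
  rewrite (partial_mxM oU k smooth_F (smooth_mxT oU smooth_Z) Ux) partial_mxT.
  rewrite mxE => /eqP; rewrite addr_eq0 => /eqP H; apply: etrans (etrans H _).
    by rewrite [RHS]mxE; apply: eq_bigr => j _; rewrite partial_mxE mxE mulrC.
  congr (- _); rewrite [LHS]mxE [RHS]mxE; apply: eq_bigr => j _; congr (_ * _).
  by rewrite mxE partial_mxE [RHS]mxE [RHS]mxE.
have h2 k l : \sum_j Z x 0 j * partial l (fun y => F y j k) x =
    - (jac_Z x *m F x) l k.
  have : partial_mx l (fun y => Z y *m F y) x 0 k = 0.
    by rewrite (partial_mx_ext oU (Y := fun=> 0) l Ux) ?partial_mx_cst ?mxE// => y /ZF.
  rewrite (partial_mxM oU l smooth_Z smooth_F Ux).
  rewrite mxE addrC => /eqP; rewrite addr_eq0 => /eqP H; apply: etrans (etrans H _).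
    by rewrite [RHS]mxE; apply: eq_bigr => j _; rewrite partial_mxE.
  congr (- _); rewrite [LHS]mxE [RHS]mxE; apply: eq_bigr => j _; congr (_ * _).
  by rewrite partial_mxE [RHS]mxE.
have sk : F x *m (jac_Z x)^T = - (jac_Z x *m F x)^T.
  by rewrite trmx_mul F_skew// mulNmx opprK.
apply/matrixP => k l.
have E (A B C : 'M[R]_d) i j : (A + B + C) i j = A i j + B i j + C i j.
  by rewrite !mxE.
rewrite E [RHS]mxE.
have -> : (jac_Z x *m F x) k l = \sum_j Z x 0 j * partial k (fun y => F y l j) x.
  by rewrite h1 sk [X in _ = - X]mxE [X in _ = - - X]mxE opprK.
have -> : (F x *m (jac_Z x)^T) k l = \sum_j Z x 0 j * partial l (fun y => F y j k) x.
  by rewrite h2 sk [LHS]mxE [X in - X = _]mxE.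
have -> : along_Z F x k l = \sum_j Z x 0 j * partial j (fun y => F y k l) x.
  by rewrite summxE; apply: eq_bigr => j _; rewrite mxE partial_mxE.
rewrite -big_split /= -big_split /=; apply: big1 => j _.
by rewrite -!mulrDr; apply: etrans (f_equal _ (closed_F j k l Ux)) (mulr0 _).
Qed.

(** Differentiate the formula for phi^2 and take traces: one side is twice tr (phi d_j phi), the
    other is the derivative of eta(zeta) = 1. *)
Lemma tr_P_along x : U x -> \tr (P x *m along_Z P x) = 0.
Proof.
move=> Ux; rewrite /along_Z mulmx_sumr linear_sum /=; apply: big1 => j _.
rewrite -scalemxAr mxtraceZ; suff -> : \tr (P x *m partial_mx j P x) = 0.
  by rewrite mulr0.
have sEZ := smooth_mxM oU (smooth_mxT oU smooth_e) smooth_Z.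
have : partial_mx j (fun y => P y *m P y) x =
    partial_mx j (fun y => (e y)^T *m Z y) x.
  rewrite (partial_mx_ext oU j Ux (Y := fun y => (e y)^T *m Z y + - 1%:M)).
    rewrite (partial_mxD oU j sEZ (smooth_mx_cst oU _) Ux).
    by rewrite partial_mx_cst addr0.
  by move=> y /P2.
rewrite (partial_mxM oU j smooth_P smooth_P Ux).
rewrite (partial_mxM oU j (smooth_mxT oU smooth_e) smooth_Z Ux) => /(congr1 mxtrace).
rewrite [LHS]linearD [RHS]linearD /= [X in X + _ = _]mxtrace_mulC.
rewrite [X in _ = X + _]mxtrace_mulC [X in _ = _ + X]mxtrace_mulC -[RHS]linearD /=.
rewrite [X in _ = \tr X]addrC.
rewrite -(partial_mxM oU j smooth_Z (smooth_mxT oU smooth_e) Ux).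
have -> : partial_mx j (fun y => Z y *m (e y)^T) x = 0.
  by rewrite (partial_mx_ext oU (Y := fun=> 1%:M) j Ux eZ) partial_mx_cst.
rewrite mxtrace0 -mulr2n => /eqP.
by rewrite mulrn_eq0 /= => /eqP.
Qed.

(* With P' = L_zeta phi and L_zeta G = 2 shape G, the vanishing of L_zeta Phi
   says P' = - 2 phi shape, so that tr (phi P') = 2 tr shape; on the other hand
   2 tr (phi P') is the derivative along zeta of tr phi^2, a constant. *)
Lemma tr_shape x : U x -> \tr (shape x) = 0.
Proof.
move=> Ux; set J := jac_Z x.
set P' := along_Z P x + J *m P x - P x *m J.
have aF : along_Z F x = along_Z G x *m (P x)^T + G x *m (along_Z P x)^T.
  rewrite /along_Z linear_sum /= mulmx_suml mulmx_sumr -big_split /=.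
  apply: eq_bigr => j _.
  rewrite /F (partial_mxM oU j smooth_G (smooth_mxT oU smooth_P) Ux) scalerDr.
  by rewrite partial_mxT linearZ /= -scalemxAl -scalemxAr.
have H0 : (shape x *m G x + shape x *m G x) *m (P x)^T + G x *m P'^T = 0.
  have -> : P'^T = (along_Z P x)^T + (P x)^T *m J^T - J^T *m (P x)^T.
    by rewrite /P' linearB linearD /= !trmx_mul.
  rewrite -lie_G// -[RHS](lie_F Ux) aF.
  rewrite !mulmxDl mulmxBr mulmxDr /F !mulmxA.
  have alg (p q r s t u : 'M[R]_d) : p + q + r + (s + t - r) = p + s + q + t.
    by apply/matrixP => i j; rewrite !mxE; ring.
  exact: alg.
have H1 : P' = - (P x *m shape x *+ 2).
  have : (P x *m (shape x *m G x + shape x *m G x) + P' *m G x) = 0.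
    have := congr1 trmx H0; rewrite linearD trmx0 /= !trmx_mul !trmxK G_sym//.
    by rewrite linearD /= shapeG_sym.
  rewrite -mulmxDl mulmxA -mulmxDl => /(congr1 (mulmx^~ (invmx (G x)))).
  rewrite mul0mx mulmxK ?G_unit// => /eqP; rewrite addrC addr_eq0 => /eqP ->.
  by rewrite mulmxDr mulr2n.
(* The two terms in [J] cancel because the trace is cyclic. *)
have H2 : \tr (P x *m P') = 0.
  rewrite /P' mulmxBr mulmxDr raddfB raddfD /= tr_P_along// add0r.
  by rewrite [X in X - _]mxtrace_mulC [P x *m (P x *m J)]mulmxA
    [X in _ - X]mxtrace_mulC mulmxA subrr.
have H3 : P x *m P' = shape x *+ 2.
  rewrite H1 mulmxN mulr2n mulmxDr mulmxA P2// mulmxBl mul1mx -mulmxA.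
  by rewrite Z_shape// mulmx0 sub0r -opprD opprK mulr2n.
move: H2; rewrite H3 raddfMn /= => /eqP.
by rewrite mulrn_eq0 /= => /eqP.
Qed.

(** * The quasi-Einstein equation *)

Variables (w : 'rV[R]_d -> R) (a b kap mu : R).
Hypothesis smooth_w : smooth_on U w.
Hypothesis ricci_G : forall x, U x ->
  ricci G x = a *: G x + b *: ((e x)^T *m e x).
Hypothesis hessian_w : forall x, U x -> hessian G w x =
  mu *: G x - b *: ((e x)^T *m e x) + kap *: ((d0 w x)^T *m d0 w x).

Let grad x := d0 w x *m invmx (G x).

(** The function zeta w. *)
Let f x := (d0 w x *m (Z x)^T) 0 0.

Lemma smooth_d0 : smooth_mx U (d0 w).
Proof.
move=> i k; apply: (smooth_ext oU) (smooth_partial k smooth_w) => x _.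
by rewrite mxE.
Qed.

Lemma smooth_grad : smooth_mx U grad.
Proof. exact: (smooth_mxM oU smooth_d0 (smooth_invG oU smooth_G G_unit)). Qed.

Lemma smooth_f : smooth_on U f.
Proof. exact: (smooth_mxM oU smooth_d0 (smooth_mxT oU smooth_Z) 0 0). Qed.

Lemma gradG x : U x -> grad x *m G x = d0 w x.
Proof. by move=> Ux; rewrite /grad mulmxKV// G_unit. Qed.

Lemma grad_e x : U x -> \sum_l grad x 0 l * e x 0 l = f x.
Proof.
move=> Ux; rewrite /f -(gradG Ux) -mulmxA GZ// [RHS]mxE.
by apply: eq_bigr => l _; rewrite [X in _ = _ * X]mxE.
Qed.

Lemma Z_e x : U x -> \sum_l Z x 0 l * e x 0 l = 1.
Proof.
move=> Ux; transitivity ((Z x *m (e x)^T) 0 0).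
  by rewrite mxE; apply: eq_bigr => l _; rewrite [X in _ = _ * X]mxE.
by rewrite eZ// mxE.
Qed.

Lemma Z_d0 x : \sum_l Z x 0 l * d0 w x 0 l = f x.
Proof.
by rewrite /f [RHS]mxE; apply: eq_bigr => l _; rewrite [X in _ = _ * X]mxE mulrC.
Qed.

Lemma row_tens (u v : 'rV[R]_d) k : row k (u^T *m v) = u 0 k *: v.
Proof. by apply/rowP => l; rewrite !mxE big_ord1 !mxE. Qed.

(** The Hessian equation with one index raised. *)
Lemma nab_grad k x : U x -> nab G k grad x = mu *: delta_mx 0 k
  + (- b * e x 0 k) *: Z x + (kap * d0 w x 0 k) *: grad x.
Proof.
move=> Ux; apply: (can_inj (mulmxK (G_unit Ux))).
have wE y : U y -> d0 w y = grad y *m G y by move=> /gradG.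
rewrite -(conab_lower oU smooth_G G_sym G_unit k smooth_grad Ux wE).
rewrite conab_hessian hessian_w// !mulmxDl -!scalemxAl ZG// gradG// -rowE.
have E (p q r : 'M[R]_d) c1 c2 c3 : row k (c1 *: p - c2 *: q + c3 *: r) =
  c1 *: row k p - c2 *: row k q + c3 *: row k r.
  by apply/rowP => l; rewrite !mxE.
by rewrite E !row_tens !scalerA mulNr scaleNr.
Qed.

Lemma nab_grad_entry k l x : U x -> nab G k grad x 0 l =
  mu * (k == l)%:R - b * e x 0 k * Z x 0 l + kap * d0 w x 0 k * grad x 0 l.
Proof.
have E (p q r : 'rV[R]_d) c1 c2 c3 : (c1 *: p + c2 *: q + c3 *: r) 0 l =
  c1 * p 0 l + c2 * q 0 l + c3 * r 0 l by rewrite !mxE.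
move=> Ux; apply: etrans (f_equal (fun v : 'rV[R]_d => v 0 l) (nab_grad k Ux)) _.
by rewrite E mxE eqxx eq_sym mulNr mulNr.
Qed.

(** Antisymmetrize the derivative of [nab_grad] in [j] and [k]. The terms with Christoffel symbols,
    with derivatives of eta and with second derivatives of [w] are symmetric and drop out, by
    absence of torsion, d eta = 0 and Schwarz. *)
Lemma grad_curv j k x : U x -> grad x *m curv G j k x =
  (b * e x 0 j) *: nab G k Z x - (b * e x 0 k) *: nab G j Z x
  + (kap * d0 w x 0 k) *: nab G j grad x - (kap * d0 w x 0 j) *: nab G k grad x.
Proof.
move=> Ux.
have se k' : smooth_on U (fun y => - b * e y 0 k').
  exact: (smoothM oU (smooth_cst oU (- b)) (smooth_e 0 k')).
have sw k' : smooth_on U (fun y => kap * d0 w y 0 k').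
  exact: (smoothM oU (smooth_cst oU kap) (smooth_d0 0 k')).
have E j' k' : nab G j' (nab G k' grad) x = mu *: delta_mx 0 k' *m Gam G j' x
    + ((- b * partial j' (fun y => e y 0 k') x) *: Z x
       + (- b * e x 0 k') *: nab G j' Z x)
    + ((kap * partial j' (fun y => d0 w y 0 k') x) *: grad x
       + (kap * d0 w x 0 k') *: nab G j' grad x).
  have s1 := smooth_mx_cst oU (mu *: delta_mx 0 k' : 'rV[R]_d).
  have s2 := smooth_mxZ oU (se k') smooth_Z.
  have s3 := smooth_mxZ oU (sw k') smooth_grad.
  rewrite (nab_ext oU G j' Ux (fun y => @nab_grad k' y)).
  rewrite (nabD oU G j' (smooth_mxD oU s1 s2) s3 Ux) (nabD oU G j' s1 s2 Ux).
  rewrite nab_cst (nabZ oU G j' (se k') smooth_Z Ux).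
  rewrite (nabZ oU G j' (sw k') smooth_grad Ux).
  rewrite (partialMl _ (smooth_derivable (smooth_e 0 k') Ux)).
  by rewrite (partialMl _ (smooth_derivable (smooth_d0 0 k') Ux)).
rewrite -(nab_comm oU smooth_G G_sym G_unit j k smooth_grad Ux) (E j k) (E k j).
have -> : mu *: (delta_mx 0 k : 'rV_d) *m Gam G j x =
    mu *: delta_mx 0 j *m Gam G k x.
  rewrite -!scalemxAl -!rowE; congr (_ *: _); apply/rowP => l.
  by rewrite mxE [RHS]mxE (Gam_sym oU G_sym _ _ _ Ux).
have -> : partial j (fun y => e y 0 k) x = partial k (fun y => e y 0 j) x.
  by apply/eqP; rewrite -subr_eq0; apply/eqP; exact: closed_e.
have -> : partial j (fun y => d0 w y 0 k) x = partial k (fun y => d0 w y 0 j) x.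
  have H j' k' : partial j' (fun y => d0 w y 0 k') x = partial j' (partial k' w) x.
    by apply: (partial_ext oU _ Ux) => y _; rewrite mxE.
  apply: etrans (H j k) (etrans _ (esym (H k j))).
  exact: (smooth_partialC oU j k smooth_w Ux).
rewrite !mulNr !scaleNr.
have alg (p q r s t r' s' : 'rV[R]_d) : p + (- q - r) + (s + t) -
    (p + (- q - r') + (s + s')) = r' - r + t - s'.
  by apply/rowP => i; rewrite !mxE; ring.
exact: alg.
Qed.

Lemma tr_nab_grad x : U x -> \sum_j nab G j grad x 0 j =
  mu * d%:R - b + kap * \sum_j d0 w x 0 j * grad x 0 j.
Proof.
move=> Ux.
transitivity (\sum_(j < d) (mu - b * (Z x 0 j * e x 0 j)
    + kap * (d0 w x 0 j * grad x 0 j))).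
  by apply: eq_bigr => j _; rewrite nab_grad_entry// eqxx mulr1n; ring.
rewrite big_split sumrB /= -!mulr_sumr Z_e// sumr_const card_ord mulr1.
by rewrite mulr_natr.
Qed.

(** Trace of [grad_curv] over [j]: the curvature side is Ric(grad w), known from the eta-Einstein
    condition. On the other side the terms in nabla zeta vanish by [tr_shape] and [nab_Z_e], and
    those in kap^2 |grad w|^2 cancel. *)
Lemma ricci_identity k x : U x ->
  (a - kap * ((d%:R - 1) * mu - b)) * d0 w x 0 k = (kap - 1) * b * f x * e x 0 k.
Proof.
move=> Ux.
have H1 : (ricci G x *m (grad x)^T) k 0 = a * d0 w x 0 k + b * (e x 0 k * f x).
  rewrite ricci_G// mulmxDl -!scalemxAl.
  have -> : G x *m (grad x)^T = (d0 w x)^T.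
    by rewrite -(gradG Ux) [RHS]trmx_mul G_sym.
  have -> : (e x)^T *m e x *m (grad x)^T = f x *: (e x)^T.
    rewrite -mulmxA; have -> : e x *m (grad x)^T = (f x)%:M.
      rewrite [LHS]mx11_scalar; congr _%:M; rewrite -grad_e// mxE.
      by apply: eq_bigr => l _; rewrite [X in _ * X]mxE mulrC.
    by rewrite mul_mx_scalar.
  by rewrite !mxE [f x * _]mulrC.
rewrite -(ricci_contract G (grad x) k x) in H1.
have trZ : \sum_j nab G j Z x 0 j = 0.
  apply: etrans (tr_shape Ux); rewrite /mxtrace.
  by apply: eq_bigr => j _; rewrite [RHS]mxE.
have eZk : \sum_j e x 0 j * nab G k Z x 0 j = 0.
  transitivity ((nab G k Z x *m (e x)^T) 0 0); last by rewrite nab_Z_e// mxE.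
  by rewrite [RHS]mxE; apply: eq_bigr => j _; rewrite [X in _ = _ * X]mxE mulrC.
pose q := \sum_j d0 w x 0 j * grad x 0 j.
have trD := tr_nab_grad Ux; rewrite -/q in trD.
have wD : \sum_j d0 w x 0 j * nab G k grad x 0 j =
    mu * d0 w x 0 k - b * e x 0 k * f x + kap * d0 w x 0 k * q.
  transitivity (\sum_j (mu * (d0 w x 0 j * (k == j)%:R)
      - b * e x 0 k * (Z x 0 j * d0 w x 0 j)
      + kap * d0 w x 0 k * (d0 w x 0 j * grad x 0 j))).
    by apply: eq_bigr => j _; rewrite nab_grad_entry//; ring.
  by rewrite big_split sumrB /= -!mulr_sumr sum_mul_delta Z_d0.
have {H1} H1 : b * (\sum_j e x 0 j * nab G k Z x 0 j)
    - b * e x 0 k * (\sum_j nab G j Z x 0 j)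
    + kap * d0 w x 0 k * (\sum_j nab G j grad x 0 j)
    - kap * (\sum_j d0 w x 0 j * nab G k grad x 0 j) =
    a * d0 w x 0 k + b * (e x 0 k * f x).
  rewrite -H1 !mulr_sumr -sumrB -big_split -sumrB /=; apply: eq_bigr => j _.
  have E (p q' r s : 'rV[R]_d) c1 c2 c3 c4 :
    (c1 *: p - c2 *: q' + c3 *: r - c4 *: s) 0 j =
    c1 * p 0 j - c2 * q' 0 j + c3 * r 0 j - c4 * s 0 j by rewrite !mxE.
  by rewrite grad_curv// E !mulrA.
rewrite trZ eZk trD wD in H1.
set o := d0 w x 0 k in H1 *; set ek := e x 0 k in H1 *; set fx := f x in H1 *.
set n := d%:R in H1 *.
clearbody o ek fx n q.
by apply/eqP; rewrite -subr_eq0; move/eqP: H1; rewrite -subr_eq0 -oppr_eq0 => /eqP H1;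
  apply/eqP; rewrite -[RHS]H1; ring.
Qed.

Lemma partial_f k x : U x -> partial k f x =
  (mu - b) * e x 0 k + kap * d0 w x 0 k * f x
  + (d0 w x *m (nab G k Z x)^T) 0 0.
Proof.
move=> Ux; transitivity (partial_mx k (fun y => d0 w y *m (Z y)^T) x 0 0).
  by rewrite partial_mxE.
rewrite (partial_pairing oU G k smooth_d0 smooth_Z Ux) [LHS]mxE; congr (_ + _).
have wE y : U y -> d0 w y = grad y *m G y by move=> /gradG.
rewrite (conab_lower oU smooth_G G_sym G_unit k smooth_grad Ux wE) -mulmxA GZ//.
transitivity (\sum_j (mu * (e x 0 j * (k == j)%:R)
    - b * e x 0 k * (Z x 0 j * e x 0 j)
    + kap * d0 w x 0 k * (grad x 0 j * e x 0 j))).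
  rewrite mxE; apply: eq_bigr => j _.
  by rewrite nab_grad_entry// [X in _ * X = _]mxE; ring.
by rewrite big_split sumrB /= -!mulr_sumr sum_mul_delta Z_e// grad_e//; ring.
Qed.

(** Contract [partial_f] with zeta; the term in nabla zeta disappears by [Z_shape]. *)
Lemma Z_partial_f x : U x ->
  \sum_k Z x 0 k * partial k f x = mu - b + kap * f x ^+ 2.
Proof.
move=> Ux.
have sh : \sum_k Z x 0 k * (d0 w x *m (nab G k Z x)^T) 0 0 = 0.
  transitivity ((Z x *m shape x *m (d0 w x)^T) 0 0).
    rewrite -mulmxA [RHS]mxE; apply: eq_bigr => k _; congr (_ * _).
    rewrite [LHS]mxE [RHS]mxE; apply: eq_bigr => l _.
    by rewrite [X in _ * X = _]mxE [X in _ = X * _]mxE [X in _ = _ * X]mxE mulrC.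
  by rewrite Z_shape// mul0mx mxE.
transitivity (\sum_k ((mu - b) * (Z x 0 k * e x 0 k)
    + kap * f x * (Z x 0 k * d0 w x 0 k)
    + Z x 0 k * (d0 w x *m (nab G k Z x)^T) 0 0)).
  by apply: eq_bigr => k _; rewrite partial_f//; ring.
by rewrite !big_split /= -!mulr_sumr sh Z_e// Z_d0; ring.
Qed.

(** Covers n = 0, where one cannot divide by d - 1: a trace-free matrix of size one is zero. *)
Lemma shape_small x : U x -> (d <= 1)%N -> shape x = 0.
Proof.
move=> Ux d1; have i0 (i : 'I_d) : val i = 0%N.
  by apply/eqP; rewrite -leqn0 -ltnS (leq_trans (ltn_ord i)).
have eqI (i j : 'I_d) : i = j by apply: val_inj; rewrite !i0.
apply/matrixP => i j; rewrite (eqI j i) [RHS]mxE; apply: etrans (tr_shape Ux).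
rewrite /mxtrace (bigD1 i)//= big1 ?addr0// => k /eqP; case.
exact: eqI.
Qed.

Lemma nab_Z0_shape x : (forall k, nab G k Z x = 0) -> shape x = 0.
Proof. by move=> H; apply/row_matrixP => k; rewrite row_shape H row0. Qed.

Lemma mu_eq_b : (forall y, U y -> f y = 0) -> forall x, U x -> mu = b.
Proof.
move=> f0 x Ux; have := Z_partial_f Ux.
rewrite f0// expr0n mulr0 addr0 big1.
  by move=> /eqP; rewrite eq_sym subr_eq0 => /eqP.
move=> k _; rewrite (partial_ext oU (g := fun=> 0) k Ux f0).
by apply: etrans (f_equal _ (partial_cst k 0 x)) (mulr0 _).
Qed.

(* Put c = a - kap ((d - 1) mu - b), so that c dw = (kap - 1) b f eta with
   f = zeta w. If c = 0 then f = 0 and mu = b, which the hypothesis on a excludes.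
   If c is neither 0 nor (kap - 1) b, then dw = 0, which makes mu G a tensor of
   rank one. In the remaining case dw = f eta, which forces mu = 0 and
   f shape = 0; where f vanishes, df = - b eta does not, and one differentiates
   f shape = 0. *)
Lemma shape_eq0 x : U x -> b != 0 -> kap != 1 -> (1 < d)%N ->
  a != kap * (d%:R - 2) * b -> shape x = 0.
Proof.
move=> Ux b0 kap1 d1 gen.
have dn0 : d%:R - 1 != 0 :> R by rewrite subr_eq0 pnatr_eq1 gtn_eqF.
have kap10 : (kap - 1) * b != 0 by rewrite mulf_neq0// subr_eq0.
pose c := a - kap * ((d%:R - 1) * mu - b).
have cE y k : U y -> c * d0 w y 0 k = (kap - 1) * b * f y * e y 0 k.
  exact: ricci_identity.
(* Evaluate [cE] on zeta, using eta(zeta) = 1. *)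
have cf y : U y -> c * f y = (kap - 1) * b * f y.
  move=> Uy; rewrite -{1}Z_d0 mulr_sumr.
  transitivity (\sum_l (kap - 1) * b * f y * (Z y 0 l * e y 0 l)).
    by apply: eq_bigr => l _; rewrite mulrCA cE//; ring.
  by rewrite -mulr_sumr Z_e// mulr1.
have [c0|c0] := eqVneq c 0.
  have f0 y : U y -> f y = 0.
    move=> /cf /eqP; rewrite c0 mul0r eq_sym mulf_eq0 (negPf kap10) /=.
    by move/eqP.
  (* With mu = b, the equation c = 0 reads a = kap (d - 2) b. *)
  case/eqP: gen; have mub := mu_eq_b f0 Ux; move: c0; rewrite /c mub.
  by move=> /eqP; rewrite subr_eq0 => /eqP ->; ring.
have [ct|ct] := eqVneq c ((kap - 1) * b); last first.
  have f0 y : U y -> f y = 0.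
    move=> /cf /eqP; rewrite -subr_eq0 -mulrBl mulf_eq0 subr_eq0 (negPf ct) /=.
    by move/eqP.
  have w0 y : U y -> d0 w y = 0.
    move=> Uy; apply/rowP => k; apply: (mulfI c0).
    by rewrite cE// f0// mxE !(mulr0, mul0r).
  have grad0 y : U y -> grad y = 0 by move=> Uy; rewrite /grad w0// mul0mx.
  (* The trace of the Hessian equation becomes (d - 1) b = 0, since mu = b. *)
  have : \sum_k nab G k grad x 0 k = 0.
    apply: big1 => k _; rewrite (nab_ext (w := fun=> 0) oU G k Ux grad0).
    by rewrite nab_cst mul0mx mxE.
  rewrite tr_nab_grad// big1 ?mulr0 ?addr0; last by move=> j _; rewrite w0// mxE mul0r.
  rewrite (mu_eq_b f0 Ux) -[X in _ - X]mulr1 -mulrBr => /eqP.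
  by rewrite mulf_eq0 (negPf b0) (negPf dn0).
have wE y : U y -> d0 w y = f y *: e y.
  by move=> Uy; apply/rowP => k; apply: (mulfI c0); rewrite cE// -ct mxE mulrA.
have gradE y : U y -> grad y = f y *: Z y.
  move=> Uy; apply: (can_inj (mulmxK (G_unit Uy))).
  by rewrite gradG// wE// -scalemxAl ZG.
have dfE k y : U y -> partial k f y = (mu - b + kap * f y ^+ 2) * e y 0 k.
  move=> Uy; rewrite partial_f// wE//.
  have -> : f y *: e y *m (nab G k Z y)^T = 0.
    rewrite -scalemxAl -[e y]trmxK -trmx_mul nab_Z_e// trmx0 scaler0 //.
  by rewrite [X in kap * X]mxE [X in _ + X]mxE; ring.
(* Compare [nab_grad] with the Leibniz rule for grad w = f zeta; the multiples of eta tensor zeta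
   combine by [dfE]. *)
have fnab k y : U y -> f y *: nab G k Z y = mu *: (delta_mx 0 k - e y 0 k *: Z y).
  move=> Uy; have := nab_grad k Uy.
  rewrite (nab_ext oU G k Uy gradE) (nabZ oU G k smooth_f smooth_Z Uy) dfE//.
  rewrite gradE// wE//; move: (nab G k Z y) => N H; apply/rowP => l.
  move/rowP/(_ l): H; rewrite !mxE eqxx /= => H.
  by apply: (addrI ((mu - b + kap * f y ^+ 2) * e y 0 k * Z y 0 l)); rewrite H; ring.
(* Trace of [fnab]: the left side vanishes by [tr_shape], the right side is (d - 1) mu. *)
have mu0 : mu = 0.
  have : \sum_k (f x *: nab G k Z x) 0 k = 0.
    transitivity (f x * \tr (shape x)); last by rewrite tr_shape// mulr0.
    by rewrite mulr_sumr; apply: eq_bigr => k _; rewrite [LHS]mxE [in RHS]mxE.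
  have E k : (f x *: nab G k Z x) 0 k = mu * (1 - Z x 0 k * e x 0 k).
    by rewrite fnab// !mxE !eqxx [e x 0 k * _]mulrC.
  rewrite (eq_bigr _ (fun k _ => E k)) -mulr_sumr sumrB Z_e// sumr_const card_ord.
  by move=> /eqP; rewrite mulf_eq0 (negPf dn0) orbF => /eqP.
have fnab0 k y : U y -> f y *: nab G k Z y = 0.
  by move=> Uy; rewrite fnab// mu0 scale0r.
apply: nab_Z0_shape => k; have [fx0|fx0] := eqVneq (f x) 0; last first.
  by apply/eqP; have /eqP := fnab0 k x Ux; rewrite scaler_eq0 (negPf fx0).
apply/eqP/negPn/negP => N0.
(* At a zero of [f], the derivative of f nabla_k zeta = 0 is df times nabla_k zeta, with df = - b
   eta. If nabla_k zeta were nonzero, eta would vanish, against eta(zeta) = 1. *)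
suff e0 j : e x 0 j = 0.
  have := Z_e Ux; rewrite big1 => [/eqP|j _]; last by rewrite e0 mulr0.
  by rewrite eq_sym oner_eq0.
have sN := smooth_nab oU smooth_G G_sym G_unit k smooth_Z.
have := partial_mxZ oU j smooth_f sN Ux.
rewrite (partial_mx_ext oU (Y := fun=> 0) j Ux (fnab0 k)) partial_mx_cst.
rewrite fx0 scale0r addr0 dfE// fx0 mu0 => /esym/eqP.
rewrite scaler_eq0 (negPf N0) orbF expr0n mulr0 addr0 sub0r mulf_eq0 oppr_eq0.
by rewrite (negPf b0) => /eqP.
Qed.

Lemma lie_metric_eq0 x : U x -> shape x = 0 -> lie_metric Z G x = 0.
Proof. by move=> Ux A0; rewrite lie_metricE// lie_G// A0 mul0mx addr0. Qed.

End AlmostCokahler.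

(** * From the chart computations to the manifold *)

Lemma bilin_delta (R : realType) d (A : 'M[R]_d) k l :
  bilin A (delta_mx 0 k) (delta_mx 0 l) = A k l.
Proof. by rewrite /bilin trmx_delta -rowE -colE !mxE. Qed.

Lemma metric_unit (R : realType) d (A : 'M[R]_d) :
  (forall u, u != 0 -> 0 < bilin A u u) -> A \in unitmx.
Proof.
move=> Apos; rewrite -row_free_unit -kermx_eq0; apply/rowV0P => u /sub_kermxP uA.
apply/eqP/negPn/negP => /Apos.
by rewrite /bilin uA mul0mx mxE ltxx.
Qed.

(** The metric has trace d, and eta tensor eta has trace eta(zeta) = 1. *)
Lemma scalar_curvature_eta_einstein (R : realType) d (G : 'rV[R]_d -> 'M[R]_d)
    (z e x : 'rV[R]_d) (a b : R) :
  G x \in unitmx -> G x *m z^T = e^T -> z *m e^T = 1%:M ->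
  ricci G x = a *: G x + b *: (e^T *m e) ->
  scalar_curvature G x = a * d%:R + b.
Proof.
move=> uG Gz ze Ric; rewrite /scalar_curvature Ric mulmxDr -!scalemxAr mulVmx//.
rewrite mulmxA -Gz mulKmx// mxtraceD !mxtraceZ mxtrace1 mxtrace_mulC.
by rewrite -[e]trmxK -trmx_mul ze trmx1 mxtrace1 mulr1.
Qed.

Lemma eta_einstein_killing (R : realType) d (M : smooth_manifold R d)
    (S : almost_contact_metric M) (a b kap rho lambda : R) (w : M -> R) :
  almost_cokahler S -> eta_einstein S a b -> smooth_fun w ->
  (forall i x, img i x ->
    ricci (acm_g S i) x + hessian (acm_g S i) (w \o param i) x
    - kap *: ((d0 (w \o param i) x)^T *m d0 (w \o param i) x) =
    (rho * scalar_curvature (acm_g S i) x + lambda) *: acm_g S i x) ->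
  b != 0 -> kap != 1 -> ((1 < d)%N -> a != kap * (d%:R - 2) * b) ->
  killing (acm_g S) (acm_zeta S).
Proof.
move=> [hEta hPhi] hRic sw hQ b0 kap1 gen i; set U := img i.
have oU : open U by exact: img_open.
have sG : smooth_mx U (acm_g S i) by move=> k l; exact: rm_smooth.
have sZ : smooth_mx U (acm_zeta S i).
  by move=> k l; rewrite [k]ord1; exact: vf_smooth.
have se : smooth_mx U (acm_eta S i).
  by move=> k l; rewrite [k]ord1; exact: of_smooth.
have sP : smooth_mx U (acm_phi S i) by move=> k l; exact: ef_smooth.
have Gs x : U x -> (acm_g S i x)^T = acm_g S i x.
  move=> Ux; apply/matrixP => k l.
  by rewrite mxE -!bilin_delta; exact: rm_sym.
have Gu x : U x -> acm_g S i x \in unitmx.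
  by move=> Ux; apply: metric_unit; exact: rm_pos.
(* The structure axioms speak of vectors; on the coordinate basis they become the matrix identities
   assumed by the chart computations. *)
have P2 x : U x -> acm_phi S i x *m acm_phi S i x =
    (acm_eta S i x)^T *m acm_zeta S i x - 1%:M.
  move=> Ux; apply/row_matrixP => k; rewrite !rowE mulmxA acm_phi2//.
  rewrite mulmxBr mulmx1 addrC; congr (_ - _).
  by rewrite /pairing mulmxA [_ *m (acm_eta S i x)^T in RHS]mx11_scalar mul_scalar_mx.
have eZ x : U x -> acm_zeta S i x *m (acm_eta S i x)^T = 1%:M.
  move=> Ux; rewrite [LHS]mx11_scalar; congr _%:M; exact: acm_eta_zeta.
have PGP x : U x -> acm_phi S i x *m acm_g S i x *m (acm_phi S i x)^T =
    acm_g S i x - (acm_eta S i x)^T *m acm_eta S i x.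
  move=> Ux; apply/matrixP => k l; rewrite -bilin_delta.
  have := acm_compat S Ux (delta_mx 0 k) (delta_mx 0 l).
  rewrite /bilin trmx_mul !mulmxA => ->.
  rewrite -/(bilin (acm_g S i x) _ _) bilin_delta [RHS]mxE [X in _ = _ + X]mxE.
  congr (_ - _); rewrite [RHS]mxE big_ord1 mxE /pairing.
  by rewrite -!rowE !mxE.
have ce x k l : U x -> d1 (acm_eta S i) x k l = 0 by move=> Ux; exact: hEta.
have cF x j k l : U x ->
    d2 (fun y => acm_g S i y *m (acm_phi S i y)^T) x j k l = 0.
  move=> Ux; apply: etrans _ (hPhi i x Ux j k l).
  apply: (f_equal (fun F => d2 F x j k l)).
  apply/funext => y; apply/matrixP => p q; rewrite [RHS]mxE -bilin_delta.
  by rewrite /bilin trmx_mul !mulmxA.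
have GZi x Ux := @GZ _ _ _ _ Gs _ _ _ P2 eZ PGP x Ux.
(* The scalar curvature is the constant a d + b, so this is the coefficient of the metric once Ric
   is moved to the right-hand side. *)
pose mu := rho * (a * d%:R + b) + lambda - a.
have sw' : smooth_on U (w \o param i) by exact: sw.
have hess x : U x -> hessian (acm_g S i) (w \o param i) x =
    mu *: acm_g S i x - b *: ((acm_eta S i x)^T *m acm_eta S i x)
    + kap *: ((d0 (w \o param i) x)^T *m d0 (w \o param i) x).
  move=> Ux; have := hQ i x Ux.
  rewrite (scalar_curvature_eta_einstein (Gu x Ux) (GZi x Ux) (eZ x Ux) (hRic i x Ux)).
  rewrite hRic// /mu.
  move: (hessian _ _ x) (acm_g S i x) => H g.
  move: (_^T *m acm_eta S i x) (_^T *m d0 _ x) => E W Q.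
  have -> : H = a *: g + b *: E + H - kap *: W - (a *: g + b *: E) + kap *: W.
    by apply/matrixP => k l; rewrite !mxE; ring.
  by rewrite Q; apply/matrixP => k l; rewrite !mxE; ring.
move=> x Ux; apply: (lie_metric_eq0 oU sG Gs Gu sZ P2 eZ PGP ce Ux).
have [d1|d1] := leqP d 1.
  exact: (shape_small oU sG Gs Gu sZ se sP P2 eZ PGP ce cF Ux d1).
have Ric x' : U x' -> ricci (acm_g S i) x' = a *: acm_g S i x' +
  b *: ((acm_eta S i x')^T *m acm_eta S i x') by exact: hRic.
exact: (shape_eq0 oU sG Gs Gu sZ se sP P2 eZ PGP ce cF sw' Ric hess Ux b0 kap1 d1
  (gen d1)).
Qed.

Local Close Scope classical_set_scope.

Theorem theorem1p4 (R : realType) (n : nat)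
    (M : smooth_manifold R (2 * n + 1)%N) (S : almost_contact_metric M)
    (a1 b1 : R) (m : \bar R) (rho : R)
    (hS : almost_cokahler S)
    (hb1 : b1 <> 0)
    (hRic : eta_einstein S a1 b1)
    (hQE : quasi_einstein (acm_g S) m rho)
    (hm : m <> 1%:E%E)
    (hprov : generic_coefficients n m a1 b1) :
  K_almost_cokahler S.
Proof.
have [m0 [w [lambda [sw hQ]]]] := hQE.
split=> //; have b0 : b1 != 0 by apply/eqP.
have d2 : (2 * n + 1)%:R - 2 = 2 * n%:R - 1 :> R by rewrite natrD natrM; ring.
have [kap1 gen] : fine (m^-1)%E != 1 /\
    a1 != fine (m^-1)%E * (2 * n%:R - 1) * b1.
  (* For m = +oo the coefficient 1/m is 0 and the proviso gives a1 <> 0; for finite m the proviso is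
     divided by m; positivity excludes m = -oo. *)
  case: m m0 hm hprov {hQE hQ} => [r| |] //; last first.
    by move=> _ _ /eqP a0; rewrite invey /= !mul0r eq_sym oner_eq0.
  rewrite lte_fin => r0 r1 gen; have rn0 := lt0r_neq0 r0.
  rewrite inver (negPf rn0) /= invr_eq1; split; apply/eqP => H.
    by apply: r1; rewrite H.
  by apply: gen; rewrite H -mulrA mulVKf.
by apply: (eta_einstein_killing hS hRic sw hQ b0 kap1) => _; rewrite d2.
Qed.
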